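(* Let $f:[0,1]\to\mathbb{R}^d$ be the self-affine function described in the context, assume $\frac{\log\lambda_m}{\log c_m}\geq\frac{\log\lambda_1}{\log c_1}$, and let $t\in\mathcal{K}_\phi\setminus\mathcal{T}_0$ have standard coding $(i_1,i_2,\dots)$. (i) There is a unique number $\alpha_0=\alpha_0(t)\in[\alpha_{\min},\alpha_{\max}]$ such that $$\limsup_{n\to\infty}\left[\sum_{i=1}^m d_i(n;t)(\log\lambda_i-\alpha_0\log c_i)\right]=0,$$ and if $\max\{\varepsilon_1,\varepsilon_m\}=1$, then $\tilde\alpha_f(t)=\alpha_0(t)$. (ii) Suppose $\varepsilon_1=\varepsilon_m=0$. For $n$ large enough that $n-L_n(t)\geq 1$, let $i:=i_{n-L_n(t)}$ and set $\chi_n(t):=1$ if $\varepsilon_i=\varepsilon_{i_\to}$ and $i_\to\in\mathcal{I}_+$, and $\chi_n(t):=0$ otherwise. Then there is a unique number $\alpha_1=\alpha_1(t)\in[\alpha_{\min},\alpha_{\max}]$ such that $$\limsup_{n\to\infty}\left[\sum_{i=1}^m d_i(n;t)(\log\lambda_i-\alpha_1\log c_i)+K\chi_n(t)\frac{L_n(t)}{n}\right]=0.$$ Moreover, $\alpha_1(t)\leq\alpha_0(t)$, and $\tilde\alpha_f(t)=\alpha_1(t)$.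
   Context: Setting. Fix integers $d\geq 1$ and $m\geq 2$, let $\mathbf{a}=(0,0,\dots,0)$ and $\mathbf{b}=(1,0,\dots,0)$ in $\mathbb{R}^d$, and fix $\boldsymbol\varepsilon=(\varepsilon_1,\dots,\varepsilon_m)\in\{0,1\}^m$ (the signature). Let $S_1,\dots,S_m$ be contractive similitudes of $\mathbb{R}^d$ with ratios $\lambda_i:=\mathrm{Lip}(S_i)\in[0,1)$ (if $m\geq 3$ one or more $S_i$ may be constant, so $\lambda_i=0$; if $m=2$ all $\lambda_i>0$), satisfying $S_1((1-\varepsilon_1)\mathbf{a}+\varepsilon_1\mathbf{b})=\mathbf{a}$, $S_m(\varepsilon_m\mathbf{a}+(1-\varepsilon_m)\mathbf{b})=\mathbf{b}$, and $S_{i-1}(\varepsilon_{i-1}\mathbf{a}+(1-\varepsilon_{i-1})\mathbf{b})=S_i((1-\varepsilon_i)\mathbf{a}+\varepsilon_i\mathbf{b})$ for $i=2,\dots,m$. Let $c_1,\dots,c_m>0$ with $\sum_{i=1}^m c_i=1$, put $\sigma_i:=\sum_{j=1}^{i-1}c_j+\varepsilon_ic_i$, $\phi_i(t):=(-1)^{\varepsilon_i}c_it+\sigma_i$, and $I_i:=\phi_i([0,1])$. Then $f:[0,1]\to\mathbb{R}^d$ is the unique continuous function with $f(t)=S_i(f(\phi_i^{-1}(t)))$ for $t\in I_i$, $i=1,\dots,m$. It is assumed throughout that $(\lambda_1,\dots,\lambda_m)\neq(c_1,\dots,c_m)$. Nondirectional Hölder exponent. $f\in\tilde C^\alpha(t_0)$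 means there is a constant $C$ with $|f(t)-f(t_0)|\leq C|t-t_0|^\alpha$ for all $t\in(0,1)$; $\tilde\alpha_f(t):=\sup\{\alpha>0:f\in\tilde C^\alpha(t)\}$ for $t\in(0,1)$. Notation. $\mathcal{I}:=\{1,\dots,m\}$, $\mathcal{I}_+:=\{i\in\mathcal{I}:\lambda_i>0\}$; $\alpha_{\min}$ and $\alpha_{\max}$ are the minimum and maximum of $\log\lambda_i/\log c_i$ over $i\in\mathcal{I}_+$. $\mathcal{K}_\phi$ is the unique nonempty compact subset of $[0,1]$ with $\mathcal{K}_\phi=\bigcup_{i\in\mathcal{I}_+}\phi_i(\mathcal{K}_\phi)$. A sequence $(i_1,i_2,\dots)\in\mathcal{I}^{\mathbb{N}}$ is a coding of $t\in[0,1]$ if $\bigcap_{n}\phi_{i_1}\circ\dots\circ\phi_{i_n}([0,1])=\{t\}$; each $t$ has at most two codings, and the lexicographically largest is its standard coding. $\mathcal{T}_0$ is the set of all endpoints of the intervals $\phi_{i_1}\circ\dots\circ\phi_{i_n}([0,1])$, $n\in\mathbb{N}$, $i_1,\dots,i_n\in\mathcal{I}$. With $(i_1,i_2,\dots)$ the standard coding of $t$: $d_i(n;t):=\frac1n\#\{j\leq n:i_j=i\}$ for $i\in\mathcal{I}$; $L_n(t):=\max\{j\leq n:i_{n-j+1}=\dots=i_n=m\}$, with $L_n(t):=0$ if $i_n<m$. For $i\in\mathcal{I}$, $i_\to:=i+1$ if $\varepsilon_i=0$ and $i_\to:=i-1$ if $\varepsilon_i=1$ (when $\varepsilon_1=\varepsilon_m=0$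 and $i\neq m$, $i_\to\in\mathcal{I}$). Put $K:=0$ if $\lambda_m=0$, and $K:=\left(\frac{\log c_m}{\log c_1}\right)\log\lambda_1-\log\lambda_m$ if $\lambda_m>0$. Conventions: $\log 0:=-\infty$ and $0\log 0:=0$ (so terms with $d_i(n;t)=0$ are $0$). *)

(* Defs.v *)
From HB Require Import structures.
From mathcomp Require Import all_boot all_order all_algebra.
From mathcomp Require Import all_classical all_reals all_analysis.

Set Implicit Arguments.
Unset Strict Implicit.
Unset Printing Implicit Defensive.

Import Order.TTheory GRing.Theory Num.Theory.
Import numFieldNormedType.Exports.

Local Open Scope classical_set_scope.
Local Open Scope ring_scope.

(* The index set {1, ..., m} with m >= 2 is 'I_p.+2, with m = p.+2: the indices
   1 and m are ord0 and ord_max, and the order of indices is that of their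
   values.  The space R^d with d >= 1 is 'rV[R]_q.+1, with d = q.+1. *)

Section Euclidean.
Variables (R : realType) (q : nat).

(* The norm `|v| of the library on row vectors is the sup norm. *)
Definition enorm (v : 'rV[R]_q.+1) : R := Num.sqrt (\sum_j v ord0 j ^+ 2).

Definition similitude (r : R) (T : 'rV[R]_q.+1 -> 'rV[R]_q.+1) : Prop :=
  forall x y, enorm (T x - T y) = r * enorm (x - y).

Definition in_nd_hoelder (f : R -> 'rV[R]_q.+1) (alpha t0 : R) : Prop :=
  exists C : R, forall t, 0 < t < 1 ->
    enorm (f t - f t0) <= C * (`|t - t0| `^ alpha).

Definition nd_hoelder_exponent (f : R -> 'rV[R]_q.+1) (t : R) : \bar R :=
  ereal_sup [set alpha%:E | alpha in
    [set alpha : R | 0 < alpha /\ in_nd_hoelder f alpha t]].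

Definition pt_a : 'rV[R]_q.+1 := 0.
Definition pt_b : 'rV[R]_q.+1 := delta_mx ord0 ord0.

End Euclidean.

Section SelfAffine.
Variables (R : realType) (q p : nat).
Implicit Types (eps : 'I_p.+2 -> bool) (lam c : 'I_p.+2 -> R).
Implicit Types (S : 'I_p.+2 -> 'rV[R]_q.+1 -> 'rV[R]_q.+1).

Definition tail_pt eps (i : 'I_p.+2) : 'rV[R]_q.+1 :=
  (1 - (eps i)%:R) *: pt_a R q + (eps i)%:R *: pt_b R q.

Definition head_pt eps (i : 'I_p.+2) : 'rV[R]_q.+1 :=
  (eps i)%:R *: pt_a R q + (1 - (eps i)%:R) *: pt_b R q.

Record self_affine_system eps S lam c : Prop := {
  sas_lam : forall i, 0 <= lam i < 1;
  sas_simil : forall i, similitude (lam i) (S i);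
  sas_two : p.+2 = 2%N -> forall i, 0 < lam i;
  sas_first : S ord0 (tail_pt eps ord0) = pt_a R q;
  sas_last : S ord_max (head_pt eps ord_max) = pt_b R q;
  sas_chain : forall i j : 'I_p.+2, j = i.+1 :> nat ->
    S i (head_pt eps i) = S j (tail_pt eps j);
  sas_c : forall i, 0 < c i;
  sas_sum : \sum_i c i = 1;
  sas_neq : lam <> c
}.

Definition sigma eps c (i : 'I_p.+2) : R :=
  \sum_(j < p.+2 | (j < i)%N) c j + (eps i)%:R * c i.

Definition phi eps c (i : 'I_p.+2) (t : R) : R :=
  (-1) ^+ (eps i) * c i * t + sigma eps c i.

(* Since t = phi i u ranges over I_i as u ranges over [0,1], the functional
   equation is f t = S i (f (phi_i^-1 t)) on I_i.  Only the values of f on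
   [0,1] are meaningful. *)
Definition self_affine_function eps S c (f : R -> 'rV[R]_q.+1) : Prop :=
  {within `[0, 1], continuous f} /\
  forall i (u : R), 0 <= u <= 1 -> f (phi eps c i u) = S i (f u).

Definition Iplus lam : set 'I_p.+2 := [set i | 0 < lam i].

(* By Hutchinson's theorem exactly one set satisfies this predicate. *)
Definition is_K_phi eps lam c (K : set R) : Prop :=
  [/\ K !=set0, compact K, K `<=` `[0, 1] &
      K = \bigcup_(i in Iplus lam) (phi eps c i @` K)].

(* phi_(i_1) o ... o phi_(i_n) for w = [:: i_1; ...; i_n] *)
Definition phi_word eps c (w : seq 'I_p.+2) (t : R) : R :=
  foldr (phi eps c) t w.

(* phi_word w is affine, so phi_word w 0 and phi_word w 1 are the two
   endpoints of the image of [0,1]. *)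
Definition T0 eps c : set R :=
  [set t | exists w, t = phi_word eps c w 0 \/ t = phi_word eps c w 1].

(* Codings are indexed from 0: s j is the digit i_(j+1). *)
Definition is_coding eps c (s : nat -> 'I_p.+2) (t : R) : Prop :=
  \bigcap_n (phi_word eps c (mkseq s n) @` `[0, 1]) = [set t].

Definition lex_le (s s' : nat -> 'I_p.+2) : Prop :=
  (forall k, s k = s' k) \/
  exists n, (forall k, (k < n)%N -> s k = s' k) /\ (s n < s' n)%N.

Definition is_standard_coding eps c (s : nat -> 'I_p.+2) (t : R) : Prop :=
  is_coding eps c s t /\ forall s', is_coding eps c s' t -> lex_le s' s.

Definition freq (s : nat -> 'I_p.+2) (i : 'I_p.+2) (n : nat) : R :=
  (count_mem i (mkseq s n))%:R / n%:R.

Definition runlen (s : nat -> 'I_p.+2) (n : nat) : nat :=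
  \max_(j < n.+1 | [forall k : 'I_n, (n - j <= k)%N ==> (s k == ord_max)]) j.

(* The fallback value of inord is never used when eps ord0 = eps ord_max = 0
   and i != ord_max. *)
Definition arrow eps (i : 'I_p.+2) : 'I_p.+2 :=
  inord (if eps i then i.-1 else i.+1).

Definition chi eps lam (s : nat -> 'I_p.+2) (n : nat) : bool :=
  (1 <= n - runlen s n)%N &&
  (let i := s (n - runlen s n).-1 in
   (eps i == eps (arrow eps i)) && (0 < lam (arrow eps i))).

(* lne extends ln by lne 0 = -oo, and 0 * -oo = 0 in \bar R *)
Definition log_ratio lam c (i : 'I_p.+2) : \bar R :=
  (lne (lam i)%:E * ((ln (c i))^-1)%:E)%E.

Definition alpha_min lam c : \bar R :=
  \big[mine/+oo%E]_(i < p.+2 | 0 < lam i) log_ratio lam c i.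

Definition alpha_max lam c : \bar R :=
  \big[maxe/-oo%E]_(i < p.+2 | 0 < lam i) log_ratio lam c i.

Definition Kcst lam c : R :=
  if lam ord_max == 0 then 0
  else ln (c ord_max) / ln (c ord0) * ln (lam ord0) - ln (lam ord_max).

Definition weighted_sum lam c (s : nat -> 'I_p.+2) (alpha : R) (n : nat)
    : \bar R :=
  (\sum_(i < p.+2) (freq s i n)%:E * (lne (lam i)%:E - (alpha * ln (c i))%:E))%E.

Definition is_alpha0 lam c (s : nat -> 'I_p.+2) (alpha : R) : Prop :=
  (alpha_min lam c <= alpha%:E <= alpha_max lam c)%E /\
  limn_esup (weighted_sum lam c s alpha) = 0%E.

Definition is_alpha1 eps lam c (s : nat -> 'I_p.+2) (alpha : R) : Prop :=
  (alpha_min lam c <= alpha%:E <= alpha_max lam c)%E /\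
  limn_esup (fun n => weighted_sum lam c s alpha n +
    (Kcst lam c * (chi eps lam s n)%:R * ((runlen s n)%:R / n%:R))%:E)%E = 0%E.

End SelfAffine.

(* Main.v *)
Require Import Defs.
From HB Require Import structures.
From mathcomp Require Import all_boot all_order all_algebra.
From mathcomp Require Import all_classical all_reals all_analysis.
From mathcomp Require Import ring lra zify.
Import Order.TTheory GRing.Theory Num.Theory.
Import numFieldNormedType.Exports.
Local Open Scope classical_set_scope.
Local Open Scope ring_scope.

(* Since t is not in T0, its coding s is followed by an orbit u in (0,1) with
   u_0 = t and u_n = phi_(s n)(u_(n+1)); zooming to level n multiplies distances
   by the product c^(n) of the first n ratios c_(s j), and increments of f by
   the product lam^(n) of the lam_(s j).  Comparing f at the two ends of the
   level-n interval around t gives lam^(n) = O((c^(n))^alpha) as soon as f is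
   alpha-Hoelder at t.  Conversely, for y <> t let n be the last level at which
   y and t share an interval: then y and t lie in different subintervals, and
   either these are separated or y and t approach a common endpoint from
   opposite sides.  At its endpoints f has a Hoelder exponent beta_0 or beta_1
   dictated by their eventually periodic codings.  If max{eps_1, eps_m} = 1 then
   beta_0 = beta_1 and the decay of lam^(n) controls both sides.  If
   eps_1 = eps_m = 0 then beta_0 <= beta_1, and the only loss occurs when t is on
   the side coded by a run of k digits m while the neighbour, entered through its
   image of 0, has the exponent beta_0: there lam_m^k has to be replaced by
   c_m^(k beta_0) = lam_m^k e^(kK), which is the correction term K chi_n L_n.
   Finally limsup (a_n + alpha b_n) / n = 0 characterizes alpha as the lower
   limit of - a_n / b_n when b_n is comparable to n. *)

Set Implicit Arguments.
Unset Strict Implicit.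
Unset Printing Implicit Defensive.

(** * Growth exponents of sequences *)

Section GrowthExponent.
Variable R : realType.
Implicit Types (a b u : nat -> R).

Definition frequently_often (P : nat -> Prop) :=
  forall N, exists2 n, (N <= n)%N & P n.

(** Replaces the extended-real limsup by its two real halves, which are compared separately with the
    two halves of [growth_exponent]. *)
Lemma limn_esup_eq0 u :
  limn_esup (fun n => (u n)%:E) = 0%E <->
  (forall e, 0 < e -> \forall n \near \oo, u n <= e) /\
  (forall e, 0 < e -> frequently_often (fun n => - e <= u n)).
Proof.
rewrite /limn_esup limf_esupE; split=> [u0|[ule uge]].
  split=> e e0.
    have : (ereal_inf [set ereal_sup [set (u x)%:E | x in V] | V in \oo] < e%:E)%E.
      by rewrite u0 lte_fin.
    move=> /ereal_inf_lt[_ [V Voo <-] Ve].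
    apply: filterS Voo => n Vn.
    rewrite -lee_fin; apply/ltW; apply: le_lt_trans Ve.
    by apply: ereal_sup_ubound; exists n.
  move=> N; apply: contrapT => nuge.
  have : (ereal_inf [set ereal_sup [set (u x)%:E | x in V] | V in \oo] <= (- e)%:E)%E.
    apply: (@le_trans _ _ (ereal_sup [set (u x)%:E | x in [set n | (N <= n)%N]])).
      apply: ereal_inf_lbound.
      by exists [set n | (N <= n)%N] => //; exists N.
    apply: ge_ereal_sup => _ [n /= Nn <-]; rewrite lee_fin leNgt.
    by apply/negP => /ltW un; apply: nuge; exists n.
  by rewrite u0 lee_fin oppr_ge0 leNgt e0.
apply/le_anti/andP; split.
  apply/lee_addgt0Pr => e e0; rewrite add0e.
  apply: (@le_trans _ _ (ereal_sup [set (u x)%:E | x in [set n | u n <= e]])).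
    by apply: ereal_inf_lbound; exists [set n | u n <= e] => //; exact: ule.
  by apply: ge_ereal_sup => _ [n /= Nn <-]; rewrite lee_fin.
apply: le_ereal_inf_tmp => _ [V [N _ NV] <-].
apply/lee_subgt0Pr => e e0; rewrite sub0e -EFinN.
have [n Nn un] := uge _ e0 N.
apply: (@le_trans _ _ (u n)%:E); first by rewrite lee_fin.
by apply: ereal_sup_ubound; exists n => //; exact: NV.
Qed.

(* [x] is the lower limit of [- a n / b n]. *)
Definition growth_exponent a b (x : R) :=
  (forall y, y < x -> \forall n \near \oo, a n + y * b n <= 0) /\
  (forall y, x < y -> frequently_often (fun n => 0 < a n + y * b n)).

(** The exponent is the supremum of the y for which [a n + y * b n] is eventually nonpositive: [lo]
    is such a y, and [hi] bounds them because [b n] is positive for n >= 1. *)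
Lemma growth_exponent_exists a b (lo hi bl : R) :
  0 < bl -> (forall n, bl * n%:R <= b n) ->
  (forall n, a n + lo * b n <= 0) -> (forall n, 0 <= a n + hi * b n) ->
  exists2 x, lo <= x <= hi & growth_exponent a b x.
Proof.
move=> bl0 blb alo ahi.
pose A := [set y | \forall n \near \oo, a n + y * b n <= 0].
have b_ge0 n : 0 <= b n by apply: le_trans (blb n); rewrite mulr_ge0// ltW.
have Alo : A lo by exact: nearW.
have Ahi : ubound A hi.
  move=> y [N _ Ny]; rewrite leNgt; apply/negP => hiy.
  have := Ny N.+1 (leqnSn N) => /= ay.
  have := ahi N.+1; have : 0 < b N.+1.
    by apply: lt_le_trans (blb _); rewrite mulr_gt0.
  by nra.
have supA : has_sup A by split; [exists lo|exists hi].
exists (sup A).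
  apply/andP; split; last by apply: ge_sup => //; exists lo.
  by apply: ub_le_sup => //; exists hi.
split=> y.
  move=> ysup; have [z Az yz] := sup_adherent (eps := sup A - y) ltac:(lra) supA.
  apply: filterS Az => n; apply: le_trans; rewrite lerD2l ler_wpM2r//; lra.
move=> supy N; apply: contrapT => H.
suff /(ub_le_sup (ex_intro _ hi Ahi)) : A y by lra.
exists N => // n /= Nn; rewrite leNgt; apply/negP => ay.
by apply: H; exists n.
Qed.

(** If y differs from x, their midpoint z separates them, and a + y b differs from a + z b by at
    least [bl] |y - z| n, which survives the division by n. At y = x, a shift of y by e / [bu]
    changes the quotient by at most e. *)
Lemma growth_exponent_limn_esup a b (bl bu x y : R) :
  0 < bl -> (forall n, bl * n%:R <= b n <= bu * n%:R) ->
  growth_exponent a b x ->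
  limn_esup (fun n => ((a n + y * b n) / n%:R)%:E) = 0%E <-> y = x.
Proof.
move=> bl0 bn [xlt xgt]; rewrite limn_esup_eq0; split=> [[yle yge]|->].
- apply/eqP; rewrite eq_le; apply/andP; split; rewrite leNgt; apply/negP => yx.
    pose z := (x + y) / 2.
    have [M _ HM] := yle (bl * (y - z) / 2) ltac:(rewrite /z; nra).
    have [n Mn] := xgt z ltac:(rewrite /z; lra) M.+1.
    have n0 : 0 < n%:R :> R by rewrite ltr0n; apply: leq_trans Mn.
    have := HM n (ltnW Mn); rewrite /= ler_pdivrMr// => H1 H2.
    have /andP[H3 _] := bn n.
    have zy : 0 < y - z by rewrite /z; lra.
    have := ler_wpM2l (ltW zy) H3.
    have : 0 < bl * (y - z) * n%:R by rewrite !mulr_gt0.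
    by lra.
  pose z := (x + y) / 2.
  have zy : 0 < z - y by rewrite /z; lra.
  have [M _ HM] := xlt z ltac:(rewrite /z; lra).
  have [n Mn] := yge (bl * (z - y) / 2) ltac:(nra) M.+1.
  have n0 : 0 < n%:R :> R by rewrite ltr0n; apply: leq_trans Mn.
  rewrite ler_pdivlMr// => H1; have /= H2 := HM n (ltnW Mn).
  have /andP[H3 _] := bn n.
  have := ler_wpM2l (ltW zy) H3.
  have : 0 < bl * (z - y) * n%:R by rewrite !mulr_gt0.
  by lra.
have bu0 : 0 < bu by have := bn 1%N; lra.
split=> e e0.
- have [M _ HM] := xlt (x - e / bu) ltac:(rewrite ltrBlDr ltrDl divr_gt0//).
  exists M.+1 => // n /= Mn.
  have n0 : 0 < n%:R :> R by rewrite ltr0n; apply: leq_trans Mn.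
  rewrite ler_pdivrMr//; have /= := HM n (ltnW Mn).
  have /andP[_ /(ler_wpM2l (ltW (divr_gt0 e0 bu0)))] := bn n.
  rewrite mulrA divfK ?gt_eqF//; lra.
- move=> N; have [n Nn H] := xgt (x + e / bu) ltac:(rewrite ltrDl divr_gt0//) N.+1.
  exists n; first exact: ltnW.
  have n0 : 0 < n%:R :> R by rewrite ltr0n; apply: leq_trans Nn.
  rewrite ler_pdivlMr//.
  have /andP[_ /(ler_wpM2l (ltW (divr_gt0 e0 bu0)))] := bn n.
  rewrite mulrA divfK ?gt_eqF//; lra.
Qed.

Lemma growth_exponent_le a a' b (x x' : R) :
  (forall n, a n <= a' n) ->
  growth_exponent a b x -> growth_exponent a' b x' -> x' <= x.
Proof.
move=> aa' [_ xgt] [xlt _]; rewrite leNgt; apply/negP => xx.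
have [N _ HN] := xlt ((x + x') / 2) ltac:(lra).
have [n Nn] := xgt ((x + x') / 2) ltac:(lra) N.
by have /= := HN n Nn; have := aa' n; lra.
Qed.

End GrowthExponent.

(** Hoelder regularity amounts to boundedness of a + al b, while [growth_exponent] speaks of its
    sign. Below x the sequence is eventually nonpositive, and the first terms go into the constant.
    Above x, positivity infinitely often at the midpoint y makes a + al b exceed [bl] (al - y) n
    there, so it is unbounded. *)
Lemma hoelder_exponent_of_growth (R : realType) (q : nat) (f : R -> 'rV[R]_q.+1)
    (t x bl : R) (a b : nat -> R) :
  0 < x -> 0 < bl -> (forall n, bl * n%:R <= b n) -> growth_exponent a b x ->
  (forall al C, 0 < al -> (forall n, a n + al * b n <= C) -> in_nd_hoelder f al t) ->
  (forall al, 0 < al -> in_nd_hoelder f al t ->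
     exists C, forall n, a n + al * b n <= C) ->
  nd_hoelder_exponent f t = x%:E.
Proof.
move=> x0 bl0 blb [xlt xgt] suff_decay nec_decay.
apply/le_anti/andP; split.
  apply: ge_ereal_sup => _ [al [al0 Hal] <-]; rewrite lee_fin leNgt.
  apply/negP => xal; have [C HC] := nec_decay _ al0 Hal.
  pose y := (x + al) / 2.
  have yal : 0 < bl * (al - y) by rewrite mulr_gt0// /y; lra.
  pose N := Num.truncn (`|C| / (bl * (al - y))).
  have [n Nn an] := xgt y ltac:(rewrite /y; lra) N.+1.
  have := HC n; have := ler_wpM2l (ltac:(rewrite /y; lra) : 0 <= al - y) (blb n).
  have : `|C| / (bl * (al - y)) < n%:R.
    have C_ge0 : 0 <= `|C| / (bl * (al - y)) by rewrite divr_ge0// ltW.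
    have /andP[_] := truncn_itv C_ge0.
    by move=> /lt_le_trans; apply; rewrite ler_nat.
  by rewrite ltr_pdivrMr//; have := ler_norm C; lra.
apply/lee_subgt0Pr => e e0.
pose al := Num.max (x - e) (x / 2).
have al0 : 0 < al by rewrite lt_max divr_gt0// orbT.
have alx : al < x by rewrite gt_max; lra.
apply: (@le_trans _ _ al%:E); first by rewrite -EFinB lee_fin le_max lexx.
apply: ereal_sup_ubound; exists al => //; split=> //.
have [N _ HN] := xlt _ alx.
apply: (suff_decay _ (\sum_(n < N) `|a n + al * b n|)) => // n.
have [nN|Nn] := ltnP n N.
  rewrite (bigD1 (Ordinal nN))//=; apply: le_trans (ler_norm _) _.
  by rewrite lerDl sumr_ge0.
by apply: le_trans (HN n Nn) _; rewrite sumr_ge0.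
Qed.

(** * The subdivision of [0,1] *)

Lemma fin_lower_bound (R : realDomainType) (T : finType) (x0 : T) (c : T -> R) :
  (forall i, 0 < c i) -> exists2 m, 0 < m & forall i, m <= c i.
Proof.
move=> c0; have [i _ ci] := @arg_minP _ _ _ x0 predT c erefl.
by exists (c i) => // j; exact: ci.
Qed.

(* The endpoints 0 and 1 of [0,1] are encoded by booleans. *)
Section Subdivision.
Variables (R : realType) (p : nat) (eps : 'I_p.+2 -> bool) (c : 'I_p.+2 -> R).
Implicit Types (i j : 'I_p.+2) (x y : R) (e : bool).

Definition end_digit e : 'I_p.+2 := if e then ord_max else ord0.

(** The preimage of the endpoint e under its own branch [phi (end_digit e)]; iterating it produces
    the eventually periodic coding of e. *)
Definition end_shift e : bool := e (+) eps (end_digit e).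

Definition start i : R := \sum_(j < p.+2 | (j < i)%N) c j.

Lemma phiE i x :
  phi eps c i x = start i + c i * (if eps i then 1 - x else x).
Proof. by rewrite /phi /sigma /start; case: (eps i) => /=; ring. Qed.

Lemma arrow_lt i j : j = i.+1 :> nat -> ~~ eps i -> j = arrow eps i.
Proof. by move=> ji /negbTE ei; apply: val_inj; rewrite /arrow ei -ji inord_val. Qed.

Lemma arrow_gt i j : i = j.+1 :> nat -> eps i -> j = arrow eps i.
Proof. by move=> ij ei; apply: val_inj; rewrite /arrow ei ij inord_val. Qed.

Hypothesis c_gt0 : forall i, 0 < c i.
Hypothesis c_sum : \sum_i c i = 1.

Lemma start_lt i j : (i < j)%N -> start i + c i <= start j.
Proof.
move=> ij; rewrite /start [leRHS](bigD1 i)//= addrC lerD2r.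
rewrite [leRHS](bigID (fun k : 'I_p.+2 => (k < i)%N))/=.
rewrite [X in _ <= X + _](eq_bigl (fun k : 'I_p.+2 => (k < i)%N)); last first.
  by move=> k; rewrite -(inj_eq val_inj)/=; lia.
by rewrite lerDl sumr_ge0// => k _; exact: ltW.
Qed.

Lemma start_succ i j : j = i.+1 :> nat -> start j = start i + c i.
Proof.
move=> ij; rewrite /start [LHS](bigD1 i)/= ?ij// addrC; congr (_ + _).
by apply: eq_bigl => k; rewrite -(inj_eq val_inj)/=; lia.
Qed.

Lemma start_ord0 : start ord0 = 0.
Proof. by rewrite /start big_pred0. Qed.

Lemma start_ord_max : start ord_max + c ord_max = 1.
Proof.
rewrite -c_sum /start [RHS](bigD1 ord_max)//= addrC; congr (_ + _).
by apply: eq_bigl => k; rewrite -(inj_eq val_inj)/=; have := ltn_ord k; lia.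
Qed.

Lemma start_ge0 i : 0 <= start i.
Proof. by rewrite sumr_ge0// => k _; exact: ltW. Qed.

Lemma start_le1 i : start i + c i <= 1.
Proof.
rewrite -start_ord_max; have [->//|im] := eqVneq i ord_max.
apply: le_trans (start_lt (j := ord_max) _) _; last by rewrite lerDl ltW.
by move: im; rewrite -(inj_eq val_inj)/=; have := ltn_ord i; lia.
Qed.

(** At least one whole interval lies between I_i and I_j. *)
Lemma start_gap cmin i j : (forall k, cmin <= c k) ->
  (i < j)%N -> j <> i.+1 :> nat -> start i + c i + cmin <= start j.
Proof.
move=> cm ij jNi; have ik : (i.+1 < p.+2)%N by have := ltn_ord j; lia.
have := @start_succ i (Ordinal ik) erefl.
have := @start_lt (Ordinal ik) j ltac:(rewrite /=; lia).
by have := cm (Ordinal ik); lra.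
Qed.

Lemma flip01 b x : 0 <= x <= 1 -> 0 <= (if b then 1 - x else x) <= 1.
Proof. by case: b; lra. Qed.

Lemma phi_dist i x y : `|phi eps c i x - phi eps c i y| = c i * `|x - y|.
Proof.
have cE : c i = `|c i| by rewrite gtr0_norm.
rewrite !phiE; case: (eps i); rewrite [in RHS]cE -normrM; last by congr `|_|; ring.
by rewrite distrC; congr `|_|; ring.
Qed.

Lemma phi01 i x : 0 <= x <= 1 -> 0 <= phi eps c i x <= 1.
Proof.
move=> /(flip01 (eps i)); rewrite phiE; move: (if _ then _ else _) => z.
by have := start_ge0 i; have := start_le1 i; have := c_gt0 i; nra.
Qed.

Lemma phi_onto x : 0 <= x <= 1 -> exists i y, 0 <= y <= 1 /\ x = phi eps c i y.
Proof.
move=> /andP[x0 x1].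
have s0 : start ord0 <= x by rewrite start_ord0.
have [i six maxi] := @arg_maxnP _ ord0 (fun i => start i <= x) val s0.
have xi : x <= start i + c i.
  have [->|im] := eqVneq i ord_max; first by rewrite start_ord_max.
  have ik : (i.+1 < p.+2)%N.
    by move: im; rewrite -(inj_eq val_inj)/=; have := ltn_ord i; lia.
  rewrite -(@start_succ i (Ordinal ik))// leNgt; apply/negP => /ltW /maxi/=; lia.
pose z := (x - start i) / c i.
have zE : c i * z = x - start i by rewrite mulrC divfK ?gt_eqF.
have z01 : 0 <= z <= 1 by have := c_gt0 i; nra.
exists i, (if eps i then 1 - z else z); split; first exact: flip01.
by rewrite phiE; case: (eps i); rewrite ?subKr zE; ring.
Qed.

Lemma phi_int_inj i j x y :
  0 < x < 1 -> 0 <= y <= 1 -> phi eps c i x = phi eps c j y -> i = j.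
Proof.
move=> x01 /(flip01 (eps j)) y01; rewrite !phiE.
have : 0 < (if eps i then 1 - x else x) < 1 by case: (eps i); lra.
move: y01; move: (if _ then _ else _) => z z01 /=.
move: (if _ then _ else _) => w w01 wz.
have ci0 := c_gt0 i; have cj0 := c_gt0 j.
apply: val_inj; apply/eqP; rewrite eqn_leq; apply/andP; split; rewrite leqNgt;
  by apply/negP => /start_lt; nra.
Qed.

Lemma phi_end e : phi eps c (end_digit e) (end_shift e)%:R = e%:R.
Proof.
rewrite phiE /end_shift; case: e => /=.
  by have := start_ord_max; case: (eps _) => /=; lra.
by have := start_ord0; case: (eps _) => /=; lra.
Qed.

(** Non-adjacent intervals are separated by a third one. For adjacent ones, e and e' are the
    parameters of the common endpoint in I_i and I_j; the two points lie on opposite sides of it, so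
    distances add. The right end of I_i has parameter 1 when [eps i] is false and the left end when
    it is true, so e = 1 singles out the neighbour [arrow eps i]. *)
Lemma phi_separation cmin i j x y : (forall k, cmin <= c k) ->
  i <> j -> 0 <= x <= 1 -> 0 <= y <= 1 ->
  cmin <= `|phi eps c i x - phi eps c j y| \/
  exists e e', [/\ phi eps c i e%:R = phi eps c j e'%:R,
    `|phi eps c i x - phi eps c j y| = c i * `|x - e%:R| + c j * `|y - e'%:R|,
    e -> j = arrow eps i & (e == e') = (eps i != eps j)].
Proof.
move=> cm ij x01 y01.
have nx (b : bool) : `|x - b%:R| = if b then 1 - x else x.
  by case: b => /=; [rewrite ler0_norm; lra|rewrite subr0 ger0_norm; lra].
have ny (b : bool) : `|y - b%:R| = if b then 1 - y else y.
  by case: b => /=; [rewrite ler0_norm; lra|rewrite subr0 ger0_norm; lra].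
have := c_gt0 i; have := c_gt0 j => cj0 ci0.
have fx := flip01 (eps i) x01; have fy := flip01 (eps j) y01.
have [ltij|ltji|/val_inj//] := ltngtP i j.
- have [ji|jNi] := eqVneq (j : nat) i.+1; last first.
    left; rewrite distrC ger0_norm.
      by have := start_gap cm ltij (elimN eqP jNi); rewrite !phiE; nra.
    by have := start_lt ltij; rewrite !phiE; nra.
  right; exists (~~ eps i), (eps j); rewrite nx ny !phiE (start_succ ji).
  split.
  + by case: (eps i); case: (eps j) => /=; ring.
  + rewrite distrC ger0_norm; last by nra.
    by case: (eps i); case: (eps j) => /=; ring.
  + exact: arrow_lt.
  + by case: (eps i); case: (eps j).
- have [ji|jNi] := eqVneq (i : nat) j.+1; last first.
    left; rewrite ger0_norm.
      by have := start_gap cm ltji (elimN eqP jNi); rewrite !phiE; nra.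
    by have := start_lt ltji; rewrite !phiE; nra.
  right; exists (eps i), (~~ eps j); rewrite nx ny !phiE (start_succ ji).
  split.
  + by case: (eps i); case: (eps j) => /=; ring.
  + rewrite ger0_norm; last by nra.
    by case: (eps i); case: (eps j) => /=; ring.
  + exact: arrow_gt.
  + by case: (eps i); case: (eps j).
Qed.

Lemma phi_end_far cmin i e x : (forall k, cmin <= c k) -> 0 <= x <= 1 ->
  i <> end_digit e -> cmin <= `|phi eps c i x - (e : bool)%:R|.
Proof.
move=> cm x01 ie; have fx := flip01 (eps i) x01; have ci0 := c_gt0 i.
case: e ie => /= ie; rewrite phiE.
  have im : (i < @ord_max p.+1)%N.
    by have := ltn_ord i; have /eqP := ie; rewrite -(inj_eq val_inj)/=; lia.
  rewrite distrC ger0_norm.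
    by have := start_lt im; have := cm ord_max; have := start_ord_max; nra.
  by have := start_le1 i; nra.
have im : (@ord0 p.+1 < i)%N.
  by have /eqP := ie; rewrite -(inj_eq val_inj)/=; lia.
rewrite subr0 ger0_norm.
  by have := start_lt im; have := cm ord0; rewrite start_ord0; nra.
by have := start_ge0 i; nra.
Qed.

(** There are at least two indices, and another one takes at least [cmin] of the total 1. This makes
    all zooms contract uniformly. *)
Lemma c_le1B cmin i : (forall k, cmin <= c k) -> c i <= 1 - cmin.
Proof.
move=> cm; pose j : 'I_p.+2 := if i == ord0 then ord_max else ord0.
have ji : j != i by rewrite /j; have [->|] := eqVneq i ord0 => //; rewrite eq_sym.
have : \sum_k c k >= c i + c j.
  rewrite (bigD1 i)//= (bigD1 j)//= lerD2l lerDl sumr_ge0// => k _; exact: ltW.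
by rewrite c_sum; have := cm j; lra.
Qed.

End Subdivision.

(** The hypotheses on [ord0] and [ord_max] guarantee that the neighbour exists, so [inord] does not
    take its fallback value. *)
Lemma phi_arrow (R : realType) (p : nat) (eps : 'I_p.+2 -> bool)
    (c : 'I_p.+2 -> R) (i : 'I_p.+2) :
  eps ord0 = false -> i <> ord_max -> eps i = eps (arrow eps i) ->
  i <> arrow eps i /\ phi eps c i 1 = phi eps c (arrow eps i) 0.
Proof.
move=> e0 im ei; rewrite !phiE -ei.
have [ei1|ei0] := boolP (eps i).
  have i0 : (0 < i)%N.
    rewrite lt0n; apply/eqP => i0; move: ei1.
    by rewrite (_ : i = ord0) ?e0//; exact: val_inj.
  have jE : arrow eps i = i.-1 :> nat.
    by rewrite /arrow ei1 inordK//; have := ltn_ord i; lia.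
  split; first by move=> /(congr1 val)/=; rewrite jE; lia.
  by rewrite (@start_succ _ _ c (arrow eps i) i) ?jE ?prednK//; ring.
have ilt : (i.+1 < p.+2)%N.
  by move/eqP: im; rewrite -(inj_eq val_inj)/=; have := ltn_ord i; lia.
have jE : arrow eps i = i.+1 :> nat by rewrite /arrow (negbTE ei0) inordK.
split; first by move=> /(congr1 val)/=; rewrite jE; lia.
by rewrite (start_succ c jE); ring.
Qed.

(** * Self-affine functions *)

Lemma exprn_le_small (R : realType) (r d : R) :
  0 <= r < 1 -> 0 < d -> exists N, r ^+ N <= d.
Proof.
move=> /andP[r0 r1] d0.
have rr : `|r| < 1 by rewrite ger0_norm.
have /cvgrPdist_le /(_ _ d0)[N _ HN] := cvg_expr rr.
exists N; have := HN N (leqnn N); rewrite /= sub0r normrN.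
by apply: le_trans; rewrite ler_norm.
Qed.

Lemma ndivr_gt0 (R : realFieldType) (x y : R) : x < 0 -> y < 0 -> 0 < x / y.
Proof. by move=> x0 y0; rewrite nmulr_rgt0// invr_lt0. Qed.

(** * The Euclidean norm *)

Section EuclideanNorm.
Variables (R : realType) (q : nat).
Implicit Types x y z : 'rV[R]_q.+1.

Lemma enorm_ge0 x : 0 <= enorm x.
Proof. exact: sqrtr_ge0. Qed.

Lemma sqr_enorm x : enorm x ^+ 2 = \sum_j x ord0 j ^+ 2.
Proof. by rewrite sqr_sqrtr// sumr_ge0// => j _; exact: sqr_ge0. Qed.

Lemma enormB x y : enorm (x - y) = enorm (y - x).
Proof.
by rewrite /enorm; congr Num.sqrt; apply: eq_bigr => j _; rewrite !mxE; ring.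
Qed.

Lemma enorm_subrr x : enorm (x - x) = 0.
Proof. by rewrite subrr /enorm big1 ?sqrtr0// => j _; rewrite mxE expr0n. Qed.

Lemma enorm_eq0 x : enorm x = 0 -> x = 0.
Proof.
move=> x0; apply/rowP => j; rewrite mxE; apply/eqP; rewrite -sqrf_eq0.
have := sqr_enorm x; rewrite x0 expr0n/= => /esym/eqP.
rewrite psumr_eq0 => [/allP/(_ j)|k _]; last exact: sqr_ge0.
by apply; rewrite mem_index_enum.
Qed.

(* The factor 2 does not affect exponents, and avoids Cauchy-Schwarz. *)
Lemma enorm_triangle2 x y z :
  enorm (x - z) <= 2 * (enorm (x - y) + enorm (y - z)).
Proof.
have a0 := enorm_ge0 (x - y); have b0 := enorm_ge0 (y - z).
rewrite -ler_sqr ?nnegrE ?enorm_ge0 ?mulr_ge0 ?addr_ge0//.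
apply: (@le_trans _ _ (2 * (enorm (x - y) ^+ 2 + enorm (y - z) ^+ 2))); last by nra.
rewrite !sqr_enorm -big_split/= mulr_sumr ler_sum// => j _.
rewrite !mxE; have := sqr_ge0 (x ord0 j - y ord0 j - (y ord0 j - z ord0 j)); lra.
Qed.

Lemma enorm_le_norm x : enorm x <= q.+1%:R * `|x|.
Proof.
rewrite -ler_sqr ?nnegrE ?enorm_ge0 ?mulr_ge0// sqr_enorm.
apply: (@le_trans _ _ (\sum_(j < q.+1) `|x| ^+ 2)).
  apply: ler_sum => j _; rewrite -[leLHS]real_normK ?num_real//.
  rewrite ler_sqr ?nnegrE// -[leRHS]/(mx_norm x) mx_normrE.
  exact: (le_bigmax _ (fun ij => `|x ij.1 ij.2|) (ord0, j)).
rewrite sumr_const card_ord exprMn -[leLHS]mulr_natl ler_wpM2r ?sqr_ge0//.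
by rewrite -natrX ler_nat -{1}(expn1 q.+1) leq_pexp2l.
Qed.

End EuclideanNorm.

(** * Inequalities between real powers *)

Section RealPowers.
Variable R : realType.
Implicit Types a b w x y z r : R.

Lemma le_powR x y b : 0 <= b -> 0 <= x -> x <= y -> x `^ b <= y `^ b.
Proof. by move=> b0 x0 xy; apply: ge0_ler_powR; rewrite ?nnegrE// (le_trans x0). Qed.

Lemma powR_le1 x b : 0 <= b -> 0 <= x <= 1 -> x `^ b <= 1.
Proof. by move=> b0 /andP[x0 x1]; rewrite (le_trans (le_powR b0 x0 x1))// powR1. Qed.

(* [r |-> a r^b / (w r)^al] is monotone, so it suffices to bound it at the two
   ends of [z, 1]. *)
Lemma powR_ends_bound a w z r b al C : 0 <= a -> 0 < w ->
  a <= C * w `^ al -> a * z `^ b <= C * (w * z) `^ al ->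
  0 < z -> z <= r <= 1 -> a * r `^ b <= C * (w * r) `^ al.
Proof.
move=> a0 w0 a1 az z0 /andP[zr r1]; have r0 : 0 < r by exact: lt_le_trans zr.
have split_pow x : 0 < x -> x `^ b = x `^ al * x `^ (b - al).
  by move=> x0; rewrite -powRD ?(gt_eqF x0) ?implybT// addrC subrK.
rewrite powRM ?(ltW w0) ?(ltW r0)// split_pow// mulrCA [leRHS]mulrA mulrC.
rewrite ler_wpM2r ?powR_ge0//.
have [alb|bal] := leP al b.
  apply: le_trans a1; rewrite ler_piMr//.
  by apply: powR_le1; [lra|rewrite (ltW r0)].
move: az; rewrite split_pow// powRM ?(ltW w0) ?(ltW z0)//.
rewrite mulrCA [leRHS]mulrA mulrC ler_pM2r ?powR_gt0//.
apply: le_trans; rewrite ler_wpM2l//.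
rewrite -(opprB al b) !powRN lef_pV2 ?posrE ?powR_gt0//.
by apply: le_powR; lra.
Qed.

Lemma decay_lnE l w al C : 0 < l -> 0 < w ->
  (ln l + al * - ln w <= C) = (l <= expR C * w `^ al).
Proof.
move=> l0 w0; rewrite /powR gt_eqF// -expRD -{2}(lnK (x := l)) ?posrE// ler_expR.
by rewrite mulrN lerBlDr.
Qed.

End RealPowers.

(** * Oscillation of f and its behaviour at the endpoints of [0,1] *)

Section SelfAffineFunction.
Variables (R : realType) (q p : nat) (eps : 'I_p.+2 -> bool).
Variables (S : 'I_p.+2 -> 'rV[R]_q.+1 -> 'rV[R]_q.+1) (lam c : 'I_p.+2 -> R).
Variable f : R -> 'rV[R]_q.+1.
Hypothesis Hsys : self_affine_system eps S lam c.
Hypothesis Hf : self_affine_function eps S c f.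
Implicit Types (i j : 'I_p.+2) (x y : R) (e : bool).

Let c_gt0 := sas_c Hsys.
Let c_sum := sas_sum Hsys.

Lemma lam_ge0 i : 0 <= lam i.
Proof. by have /andP[] := sas_lam Hsys i. Qed.

Lemma lam_lt1 i : lam i < 1.
Proof. by have /andP[] := sas_lam Hsys i. Qed.

Lemma bool01 e : 0 <= (e%:R : R) <= 1.
Proof. by case: e; rewrite lexx ler01. Qed.

Lemma f_phi_dist i x y : 0 <= x <= 1 -> 0 <= y <= 1 ->
  enorm (f (phi eps c i x) - f (phi eps c i y)) = lam i * enorm (f x - f y).
Proof. by move=> x01 y01; rewrite !(Hf.2)//; exact: (sas_simil Hsys). Qed.

Lemma f_osc : exists2 M, 0 < M &
  forall x y, 0 <= x <= 1 -> 0 <= y <= 1 -> enorm (f x - f y) <= M.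
Proof.
have : compact (f @` `[0, 1]).
  by apply: continuous_compact; [exact: Hf.1|exact: segment_compact].
move=> /compact_bounded[B [_ HB]].
exists (q.+1%:R * (2 * (`|B| + 1))); first by rewrite !mulr_gt0// ltr_pwDr.
have fB x : 0 <= x <= 1 -> `|f x| <= `|B| + 1.
  move=> x01; apply: HB; first by rewrite (le_lt_trans (ler_norm _)) ?ltrDl.
  by exists x => //; rewrite /= in_itv/=.
move=> x y x01 y01; apply: le_trans (enorm_le_norm _) _.
rewrite ler_wpM2l// (le_trans (ler_normB _ _))//.
by have := fB _ x01; have := fB _ y01; lra.
Qed.

Let end_pt e := if e then pt_b R q else pt_a R q.

Lemma similitude_end e :
  S (end_digit p e) (end_pt (end_shift eps e)) = end_pt e.
Proof.
case: e => /=.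
  rewrite -(sas_last Hsys) /end_shift/= /head_pt.
  by case: (eps _) => /=; rewrite ?subrr ?subr0 !(scale1r, scale0r, add0r, addr0).
rewrite -(sas_first Hsys) /end_shift/= /tail_pt.
by case: (eps _) => /=; rewrite ?subrr ?subr0 !(scale1r, scale0r, add0r, addr0).
Qed.

(** The error [D] at an endpoint is a ratio less than 1 times the error at its shift; on two
    endpoints this forces both errors to vanish. *)
Lemma f_end e : f e%:R = end_pt e.
Proof.
pose D e := enorm (f e%:R - end_pt e).
have De b : D b = lam (end_digit p b) * D (end_shift eps b).
  rewrite /D -[in LHS](phi_end eps c_sum b) -[in LHS]similitude_end.
  by rewrite (Hf.2) ?bool01//; exact: (sas_simil Hsys).
have D_ge0 b : 0 <= D b by exact: enorm_ge0.
suff D0 b : D b = 0 by apply/eqP; rewrite -subr_eq0; apply/eqP/enorm_eq0/D0.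
have l0 b := lam_ge0 (end_digit p b); have l1 b := lam_lt1 (end_digit p b).
have := De true; have := De false.
have := l0 true; have := l0 false; have := l1 true; have := l1 false.
have := D_ge0 true; have := D_ge0 false.
case: b; case: (end_shift eps true); case: (end_shift eps false);
  move: (D true) (D false) (lam _) (lam _) => d1 d0 r0 r1; by nra.
Qed.

Lemma f_ends_dist : enorm (f 0 - f 1) = 1.
Proof.
rewrite (f_end false) (f_end true) /= /pt_a /pt_b sub0r /enorm (bigD1 ord0)//=.
rewrite big1 ?addr0 => [|j j0]; last by rewrite !mxE (negbTE j0) andbF oppr0 expr0n.
by rewrite !mxE eqxx/= sqrrN expr1n sqrtr1.
Qed.

Lemma cmin_exists : exists2 m, 0 < m & forall i, m <= c i.
Proof. exact: (fin_lower_bound ord0). Qed.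

(* Zooming in at [e] multiplies the distance to the endpoint by at least
   [(1 - m)^-1], so it exceeds [m] after finitely many steps. *)
Lemma end_ind m (P : bool -> R -> Prop) : 0 < m -> (forall i, m <= c i) ->
  (forall e x, 0 <= x <= 1 -> m <= `|x - e%:R| -> P e x) ->
  (forall e x, 0 <= x <= 1 -> P (end_shift eps e) x ->
     P e (phi eps c (end_digit p e) x)) ->
  forall e x, 0 <= x <= 1 -> x != e%:R -> P e x.
Proof.
move=> m0 cm Pfar Pstep e x x01 xe.
have m1 : m < 1 by have := c_le1B c_gt0 c_sum ord0 cm; have := c_gt0 ord0; lra.
have xe0 : 0 < `|x - e%:R| by rewrite normr_gt0 subr_eq0.
have [N] := @exprn_le_small _ (1 - m) _ ltac:(lra) xe0.
elim: N => [|N IH] in e x x01 {xe xe0} *.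
  by rewrite expr0 => xe; apply: Pfar => //; lra.
have [i [y [y01 ->]]] := phi_onto eps c_gt0 c_sum x01.
have [->|/eqP ie _] := eqVneq i (end_digit p e); last first.
  by apply: Pfar; [exact: phi01|exact: phi_end_far].
rewrite -{1}(phi_end eps c_sum e) phi_dist// exprS => le_c.
apply: Pstep => //; apply: IH => //.
have := c_le1B c_gt0 c_sum (end_digit p e) cm.
by have := exprn_ge0 N (ltac:(lra) : 0 <= 1 - m); have := c_gt0 (end_digit p e); nra.
Qed.

(* [beta e] is the Hoelder exponent of [f] at the endpoint [e], computed along
   the eventually periodic coding of [e]; [h] is a coboundary that makes the
   renormalization at [e] exact.  When [lam (end_digit p e) = 0] any exponent is
   admissible. *)
Record end_exponents (beta h : bool -> R) : Prop := {
  end_beta_gt0 : forall e, 0 < beta e;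
  end_h_gt0 : forall e, 0 < h e;
  end_beta_shift : forall e, beta (end_shift eps e) = beta e;
  end_lam_le : forall e, lam (end_digit p e) * h (end_shift eps e) <=
    h e * c (end_digit p e) `^ beta e;
  end_lam_ge : forall e, 0 < lam (end_digit p e) ->
    h e * c (end_digit p e) `^ beta e <=
      lam (end_digit p e) * h (end_shift eps e) }.

Section EndExponents.
Variables (beta h : bool -> R).
Hypothesis Hbh : end_exponents beta h.

Let beta_gt0 := end_beta_gt0 Hbh.
Let h_gt0 := end_h_gt0 Hbh.

(** Zooming at e by [end_ind]: the increment of f scales by lam, and [end_lam_le] says that the
    bound weighted by h e scales at least as much. Far from e the global oscillation of f
    suffices. *)
Lemma end_hoelder : exists2 C, 0 < C & forall e x, 0 <= x <= 1 ->
  enorm (f x - f e%:R) <= C * `|x - e%:R| `^ beta e.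
Proof.
have [M M0 HM] := f_osc; have [m m0 cm] := cmin_exists.
have [k k0 Hk] : exists2 k, 0 < k & forall e, k <= h e * m `^ beta e.
  by apply: (fin_lower_bound true) => e; rewrite mulr_gt0 ?powR_gt0.
have hs_gt0 : 0 < h true + h false by rewrite addr_gt0.
have Mk : 0 < M / k by rewrite divr_gt0.
exists (M / k * (h true + h false)); first by rewrite mulr_gt0.
move=> e x x01; have [->|xe] := eqVneq x e%:R.
  by rewrite enorm_subrr (mulr_ge0 (ltW (mulr_gt0 Mk hs_gt0)))// powR_ge0.
suff : enorm (f x - f e%:R) <= M / k * (h e * `|x - e%:R| `^ beta e).
  move=> /le_trans; apply; rewrite -[leRHS]mulrA ler_wpM2l ?(ltW Mk)//.
  rewrite ler_wpM2r ?powR_ge0//; have := h_gt0 (~~ e).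
  by case: e {xe} => /=; lra.
apply: (end_ind (P := fun e x => enorm (f x - f e%:R) <=
  M / k * (h e * `|x - e%:R| `^ beta e)) m0 cm) => // {e x xe x01}[e x x01 mx|e x x01].
  apply: (@le_trans _ _ (M / k * k)).
    by rewrite divfK ?gt_eqF//; apply: HM => //; exact: bool01.
  rewrite ler_wpM2l ?(ltW Mk)// (le_trans (Hk e))//.
  by rewrite ler_pM2l// le_powR// ltW.
rewrite -[in X in _ -> X](phi_end eps c_sum e).
rewrite f_phi_dist ?bool01// phi_dist// => IH.
apply: le_trans (ler_wpM2l (lam_ge0 _) IH) _.
rewrite (end_beta_shift Hbh) powRM ?(ltW (c_gt0 _))// mulrCA.
rewrite ler_wpM2l ?(ltW Mk)// !mulrA ler_wpM2r ?powR_ge0//.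
exact: end_lam_le.
Qed.

End EndExponents.

End SelfAffineFunction.

(** * Construction of the endpoint exponents, and bounds on the log ratios *)

Section EndExponentsExist.
Variables (R : realType) (q p : nat) (eps : 'I_p.+2 -> bool).
Variables (S : 'I_p.+2 -> 'rV[R]_q.+1 -> 'rV[R]_q.+1) (lam c : 'I_p.+2 -> R).
Hypothesis Hsys : self_affine_system eps S lam c.

Let c_gt0 := sas_c Hsys.

Lemma ln_c_lt0 i : ln (c i) < 0.
Proof.
have [m m0 cm] := cmin_exists Hsys.
have := c_le1B c_gt0 (sas_sum Hsys) i cm; have := c_gt0 i.
by move=> ? ?; apply: ln_lt0; lra.
Qed.

Lemma powR_ln_ratio (x l : R) : ln x < 0 -> 0 < x -> 0 < l -> x `^ (ln l / ln x) = l.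
Proof.
by move=> lx x0 l0; rewrite /powR gt_eqF// divfK ?lnK// lt_eqF.
Qed.

(* If max{eps_1, eps_m} = 1, both endpoints have codings with the same tail. *)
Lemma end_exponents_same : eps ord0 || eps ord_max ->
  exists beta h, end_exponents eps lam c beta h /\ beta true = beta false.
Proof.
move=> e1.
(* A vanishing ratio only has to be bounded above, so any value in (0,1) can stand for it. *)
pose l e := if 0 < lam (end_digit p e) then lam (end_digit p e) else 2^-1.
have l01 e : 0 < l e < 1.
  by rewrite /l; case: ifP => [->|_]; [exact: lam_lt1 Hsys _|lra].
have lam_le e : lam (end_digit p e) <= l e.
  by rewrite /l; case: ltP => // /le_trans; apply; rewrite invr_ge0.
have lamE e : 0 < lam (end_digit p e) -> lam (end_digit p e) = l e.
  by rewrite /l => ->.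
have ln_l e : ln (l e) < 0 by exact: ln_lt0.
have ln_c e := ln_c_lt0 (end_digit p e).
have ll e : 0 < l e by case/andP: (l01 e).
have mk b (h : bool -> R) : 0 < b -> (forall e, 0 < h e) ->
    (forall e, l e * h (end_shift eps e) = h e * c (end_digit p e) `^ b) ->
    exists beta h', end_exponents eps lam c beta h' /\ beta true = beta false.
  move=> b0 h0 hE; exists (fun=> b), h; split=> //; split=> // e.
    by rewrite -hE ler_pM2r.
  by move=> /lamE ->; rewrite -hE.
have [es|es] := eqVneq (end_shift eps true) (end_shift eps false).
  (* Here e' is fixed by the shift, and b is the exponent of its own branch. *)
  pose e' := end_shift eps true; pose b := ln (l e') / ln (c (end_digit p e')).
  apply: (mk b (fun e => l e / c (end_digit p e) `^ b)).
  - exact: ndivr_gt0.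
  - by move=> e; rewrite divr_gt0// powR_gt0.
  move=> e; rewrite (_ : end_shift eps e = e'); last by case: e.
  by rewrite powR_ln_ratio// divff ?gt_eqF// mulr1 divfK// gt_eqF// powR_gt0.
have [s1 s0] : end_shift eps true = false /\ end_shift eps false = true.
  by move: es e1; rewrite /end_shift /=; case: (eps ord0); case: (eps ord_max).
(* The shift now swaps the endpoints, so b is the exponent of the composition of the two end
   branches. *)
pose b := (ln (l true) + ln (l false)) /
  (ln (c (end_digit p true)) + ln (c (end_digit p false))).
have b0 : 0 < b.
  apply: ndivr_gt0.
    by have := ln_l true; have := ln_l false; lra.
  by have := ln_c true; have := ln_c false; lra.
have cb : c (end_digit p true) `^ b * c (end_digit p false) `^ b = l true * l false.
  rewrite -powRM ?(ltW (c_gt0 _))// /b -lnM ?posrE// -lnM ?posrE//.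
  rewrite powR_ln_ratio ?mulr_gt0// lnM ?posrE//.
  by have := ln_c true; have := ln_c false; lra.
(* Normalizing h to 1 at 0, the relation at 0 determines h at 1; the relation at 1 is then [cb]. *)
apply: (mk b (fun e => if e then c (end_digit p false) `^ b / l false else 1)) => //.
  by case=> //; rewrite divr_gt0// powR_gt0.
case; rewrite ?s1 ?s0; last by rewrite mulrC divfK ?gt_eqF// mul1r.
by rewrite mulrAC [X in _ = X / _]mulrC cb mulfK ?gt_eqF// mulr1.
Qed.

Hypothesis eps0 : eps ord0 = false.
Hypothesis epsm : eps ord_max = false.
Hypothesis Hratio : (log_ratio lam c ord0 <= log_ratio lam c ord_max)%E.

Lemma log_ratio_gt0 i : 0 < lam i -> log_ratio lam c i = (ln (lam i) / ln (c i))%:E.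
Proof. by move=> li; rewrite /log_ratio lne_EFin// -EFinM. Qed.

(** A zero ratio at [ord0] would give the log ratio +oo there, which cannot lie below the finite one
    at [ord_max]. *)
Lemma lam_ord0_gt0 : 0 < lam ord_max -> 0 < lam ord0.
Proof.
move=> lm; have := lam_ge0 Hsys ord0; rewrite le_eqVlt => /orP[/eqP l0|//].
move: Hratio; rewrite (log_ratio_gt0 lm) /log_ratio -l0 le0_lneNy//.
by rewrite lt0_mulNye ?leye_eq// lte_fin invr_lt0 ln_c_lt0.
Qed.

Lemma end_exponents_split : exists beta, [/\ end_exponents eps lam c beta (fun=> 1),
  beta false <= beta true,
  0 < lam ord0 -> lam ord0 = c ord0 `^ beta false,
  0 < lam ord_max -> lam ord_max * expR (Kcst lam c) = c ord_max `^ beta false &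
  0 <= Kcst lam c].
Proof.
have ratio_gt0 i : 0 < lam i -> 0 < ln (lam i) / ln (c i).
  move=> li; apply: ndivr_gt0; last exact: ln_c_lt0.
  by apply: ln_lt0; rewrite li (lam_lt1 Hsys).
have lam_pow i : 0 < lam i -> lam i = c i `^ (ln (lam i) / ln (c i)).
  by move=> li; rewrite powR_ln_ratio// ln_c_lt0.
pose b0 := if 0 < lam ord0 then ln (lam ord0) / ln (c ord0) else 1.
(* The default [b0] agrees with the convention K = 0 when lam_m = 0. *)
pose b1 := if 0 < lam ord_max then ln (lam ord_max) / ln (c ord_max) else b0.
have b0_gt0 : 0 < b0 by rewrite /b0; case: ifP => // /ratio_gt0.
have b1_gt0 : 0 < b1 by rewrite /b1; case: ifP => // /ratio_gt0.
have b01 : b0 <= b1.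
  rewrite /b1; case: ifP => // lm; have l0 := lam_ord0_gt0 lm.
  by move: Hratio; rewrite !log_ratio_gt0// lee_fin /b0 l0.
have lam0E : 0 < lam ord0 -> lam ord0 = c ord0 `^ b0.
  by move=> l0; rewrite /b0 l0; exact: lam_pow.
have lammE : 0 < lam ord_max -> lam ord_max = c ord_max `^ b1.
  by move=> l0; rewrite /b1 l0; exact: lam_pow.
have KE : Kcst lam c = ln (c ord_max) * (b0 - b1).
  rewrite /Kcst; have [lm|] := eqVneq (lam ord_max) 0.
    by rewrite /b1 lm ltxx subrr mulr0.
  rewrite neq_lt ltNge (lam_ge0 Hsys)/= => lm.
  rewrite /b1 lm /b0 (lam_ord0_gt0 lm).
  have n0 : ln (c ord0) != 0 by rewrite lt_eqF// ln_c_lt0.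
  have nm : ln (c ord_max) != 0 by rewrite lt_eqF// ln_c_lt0.
  by field; rewrite n0 nm.
exists (fun e => if e then b1 else b0); split=> //.
- split=> //; first by case.
  + by case; rewrite /end_shift/= ?epsm ?eps0.
  + case; rewrite !(mul1r, mulr1).
      have := lam_ge0 Hsys ord_max; rewrite le_eqVlt => /orP[/eqP <-|/lammE <-//].
      exact: powR_ge0.
    have := lam_ge0 Hsys ord0; rewrite le_eqVlt => /orP[/eqP <-|/lam0E <-//].
    exact: powR_ge0.
  + by case=> /=; rewrite !(mul1r, mulr1); [move=> /lammE <-|move=> /lam0E <-].
- move=> /[dup] lm /lammE ->.
  rewrite KE /powR gt_eqF// -expRD; congr expR; ring.
- by rewrite KE; have := ln_c_lt0 ord_max; nra.
Qed.

Lemma alpha_min_real i0 : 0 < lam i0 -> exists lo, [/\ 0 < lo,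
  alpha_min lam c = lo%:E &
  forall i, 0 < lam i -> ln (lam i) <= lo * ln (c i)].
Proof.
move=> li0; pose P i := 0 < lam i.
have [i /= li aE] := @eq_bigmin _ _ _ +oo%E i0 P (log_ratio lam c) li0
  (fun i _ => leey _).
exists (ln (lam i) / ln (c i)); split.
- apply: ndivr_gt0; last exact: ln_c_lt0.
  by apply: ln_lt0; rewrite (lam_lt1 Hsys) andbT; exact: li.
- by rewrite /alpha_min aE log_ratio_gt0.
move=> j lj; have := bigmin_le_cond +oo%E (log_ratio lam c) (lj : P j).
rewrite aE !log_ratio_gt0// lee_fin => H.
by rewrite -ler_ndivlMr ?ln_c_lt0.
Qed.

Lemma alpha_max_real i0 : 0 < lam i0 -> exists hi,
  alpha_max lam c = hi%:E /\
  forall i, 0 < lam i -> hi * ln (c i) <= ln (lam i).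
Proof.
move=> li0; pose P i := 0 < lam i.
have [i /= li aE] := @eq_bigmax _ _ _ -oo%E i0 P (log_ratio lam c) li0
  (fun i _ => leNye _).
exists (ln (lam i) / ln (c i)); split.
  by rewrite /alpha_max aE log_ratio_gt0.
move=> j lj; have := le_bigmax_cond -oo%E (log_ratio lam c) (lj : P j).
rewrite aE !log_ratio_gt0// lee_fin => H.
by rewrite -ler_ndivrMr ?ln_c_lt0.
Qed.

End EndExponentsExist.

(** * Codings and orbits *)

Section Runs.
Variables (p : nat) (s : nat -> 'I_p.+2).

Lemma runlen_run n k : s n <> ord_max ->
  (forall j, (j < k)%N -> s (n.+1 + j) = ord_max) -> runlen s (n.+1 + k) = k.
Proof.
move=> sn run; apply/eqP; rewrite eqn_leq; apply/andP; split.
  apply/bigmax_leqP => /= j /forallP/= H; rewrite leqNgt; apply/negP => kj.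
  have nlt : (n < n.+1 + k)%N by lia.
  have := H (Ordinal nlt); rewrite /= => /implyP/(_ ltac:(lia))/eqP; exact: sn.
have kn : (k < (n.+1 + k).+1)%N by lia.
apply: (leq_bigmax_cond (Ordinal kn)); apply/forallP => /= i; apply/implyP => ki.
have ik := ltn_ord i; apply/eqP; rewrite -(@subnKC n.+1 i); last by lia.
by apply: run; lia.
Qed.

Lemma runlen_all n : (forall j, (j < n)%N -> s j = ord_max) -> runlen s n = n.
Proof.
move=> run; apply/eqP; rewrite eqn_leq; apply/andP; split.
  by apply/bigmax_leqP => /= j _; rewrite -ltnS.
apply: (leq_bigmax_cond (@ord_max n)); apply/forallP => /= i; apply/implyP => _.
by rewrite run.
Qed.

(** In the second case k is the run length L_n, and [s n'], with digits counted from 0, is the digit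
    i_(n - L_n). *)
Lemma run_decomposition n : (forall j, (j < n)%N -> s j = ord_max) \/
  exists n' k, [/\ n = (n'.+1 + k)%N, s n' <> ord_max &
    forall j, (j < k)%N -> s (n'.+1 + j) = ord_max].
Proof.
elim: n => [|n [IH|[n' [k [-> sn' run]]]]]; first by left.
- have [sn|/eqP sn] := eqVneq (s n) ord_max; last first.
    by right; exists n, 0%N; split; rewrite ?addn0.
  by left => j; rewrite ltnS leq_eqVlt => /orP[/eqP ->|/IH].
- have [sn|/eqP sn] := eqVneq (s (n'.+1 + k)%N) ord_max; last first.
    by right; exists (n'.+1 + k)%N, 0%N; split; rewrite ?addn0.
  right; exists n', k.+1; split; rewrite ?addnS// => j.
  by rewrite ltnS leq_eqVlt => /orP[/eqP ->|/run].
Qed.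

End Runs.

(** * Products of ratios along a coding, and digit frequencies *)

Section DigitProducts.
Variables (R : realType) (p : nat) (s : nat -> 'I_p.+2).
Implicit Types g : 'I_p.+2 -> R.

Definition digit_prod g n : R := \prod_(j < n) g (s j).

Lemma digit_prodS g n : digit_prod g n.+1 = digit_prod g n * g (s n).
Proof. by rewrite /digit_prod big_ord_recr. Qed.

Lemma digit_prod0 g : digit_prod g 0 = 1.
Proof. by rewrite /digit_prod big_ord0. Qed.

Lemma digit_prod_gt0 g n : (forall n, 0 < g (s n)) -> 0 < digit_prod g n.
Proof. by move=> g0; rewrite prodr_gt0. Qed.

Lemma digit_prod_run g i n k : (forall j, (j < k)%N -> s (n + j) = i) ->
  digit_prod g (n + k) = digit_prod g n * g i ^+ k.
Proof.
elim: k => [|k IH] run; first by rewrite addn0 expr0 mulr1.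
rewrite addnS digit_prodS IH => [|j jk]; last by apply: run; lia.
by rewrite run// exprSr mulrA.
Qed.

End DigitProducts.

Section Digits.
Variables (R : realType) (p : nat) (s : nat -> 'I_p.+2).
Implicit Types g : 'I_p.+2 -> R.

Lemma ln_digit_prodS g n : (forall n, 0 < g (s n)) ->
  ln (digit_prod s g n.+1) = ln (digit_prod s g n) + ln (g (s n)).
Proof. by move=> g0; rewrite digit_prodS lnM ?posrE ?digit_prod_gt0. Qed.

Lemma sum_freq_ln g n : (forall n, 0 < g (s n)) ->
  \sum_i freq R s i n * ln (g i) = ln (digit_prod s g n) / n%:R.
Proof.
move=> g0; rewrite /freq.
under eq_bigr => i _ do rewrite mulrAC.
rewrite -mulr_suml; congr (_ / _).
elim: n => [|n IH].
  by rewrite digit_prod0 ln1 big1// => i _; rewrite mul0r.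
rewrite ln_digit_prodS// -IH.
under eq_bigr => i _ do
  rewrite mkseqS -cats1 count_cat/= addn0 natrD mulrDl.
rewrite big_split/=; congr (_ + _).
rewrite (bigD1 (s n))//= eqxx mul1r big1 ?addr0// => i /negbTE sni.
by rewrite eq_sym sni mul0r.
Qed.

(** A digit with lam i = 0 never occurs in s, so its term is 0 times -oo, which is 0, and the sum is
    real. Both sides are 0 at n = 0, where the division by 0 gives 0. *)
Lemma weighted_sumE (lam c : 'I_p.+2 -> R) y n :
  (forall i, 0 <= lam i) -> (forall i, 0 < c i) -> (forall n, 0 < lam (s n)) ->
  weighted_sum lam c s y n =
  ((ln (digit_prod s lam n) + y * - ln (digit_prod s c n)) / n%:R)%:E.
Proof.
move=> lam0 c0 lam_s; rewrite /weighted_sum.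
rewrite (eq_bigr (fun i =>
  (freq R s i n * ln (lam i) - y * (freq R s i n * ln (c i)))%:E)).
  rewrite sumEFin big_split/= sumrN -mulr_sumr !sum_freq_ln//; congr EFin; ring.
move=> i _; have := lam0 i; rewrite le_eqVlt => /orP[/eqP li|li].
  suff -> : freq R s i n = 0 by rewrite mul0e !mul0r mulr0 subr0.
  rewrite /freq (_ : count_mem i _ = 0%N) ?mul0r//.
  apply/eqP; rewrite -leqn0 leqNgt -has_count; apply/hasPn => x /mapP[k _ ->].
  by apply/eqP => ski; have := lam_s k; rewrite ski -li ltxx.
by rewrite lne_EFin// -EFinB -EFinM; congr EFin; ring.
Qed.

Lemma ln_digit_prod_le (g g' : 'I_p.+2 -> R) (a : R) :
  (forall n, 0 < g (s n)) -> (forall n, 0 < g' (s n)) ->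
  (forall n, ln (g (s n)) <= a * ln (g' (s n))) ->
  forall n, ln (digit_prod s g n) <= a * ln (digit_prod s g' n).
Proof.
move=> g0 g0' gg'; elim=> [|n IH]; first by rewrite !digit_prod0 ln1 mulr0.
by rewrite !ln_digit_prodS// mulrDr lerD.
Qed.

Lemma ln_digit_prod_ge (g g' : 'I_p.+2 -> R) (a : R) :
  (forall n, 0 < g (s n)) -> (forall n, 0 < g' (s n)) ->
  (forall n, a * ln (g' (s n)) <= ln (g (s n))) ->
  forall n, a * ln (digit_prod s g' n) <= ln (digit_prod s g n).
Proof.
move=> g0 g0' gg'; elim=> [|n IH]; first by rewrite !digit_prod0 ln1 mulr0.
by rewrite !ln_digit_prodS// mulrDr lerD.
Qed.

Lemma ln_digit_prod_linear (c : 'I_p.+2 -> R) : (forall i, 0 < c i) -> \sum_i c i = 1 ->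
  exists bl bu, 0 < bl /\ forall n, bl * n%:R <= - ln (digit_prod s c n) <= bu * n%:R.
Proof.
move=> c0 c1; have [m m0 cm] := fin_lower_bound ord0 c0.
have cm1 i := c_le1B c0 c1 i cm.
have m1 : m < 1 by have := cm1 ord0; have := c0 ord0; lra.
exists (- ln (1 - m)), (- ln m); split; first by rewrite oppr_gt0 ln_lt0//; lra.
elim=> [|n /andP[IH1 IH2]]; first by rewrite digit_prod0 ln1 oppr0 !mulr0 lexx.
have : ln m <= ln (c (s n)) <= ln (1 - m) by rewrite !ler_ln ?posrE ?cm ?cm1//; lra.
by rewrite ln_digit_prodS// -natr1; lra.
Qed.

End Digits.

Lemma phi_word_mkseqS (R : realType) (p : nat) (eps : 'I_p.+2 -> bool)
    (c : 'I_p.+2 -> R) (s : nat -> 'I_p.+2) n x :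
  phi_word eps c (mkseq s n.+1) x = phi_word eps c (mkseq s n) (phi eps c (s n) x).
Proof. by rewrite /phi_word mkseqS foldr_rcons. Qed.

(** Here u n is the parameter of t in its level-n interval; it is not 0 or 1 because t avoids [T0].
    Being interior, it has a unique next digit, so the invariance of K passes from u n to u (n+1)
    and shows that the digit has positive ratio. *)
Lemma coding_orbit (R : realType) (p : nat) (eps : 'I_p.+2 -> bool)
    (lam c : 'I_p.+2 -> R) (K : set R) (t : R) (s : nat -> 'I_p.+2) :
  (forall i, 0 < c i) -> is_K_phi eps lam c K -> (K `\` T0 eps c) t ->
  is_coding eps c s t -> exists u : nat -> R, [/\ u 0%N = t,
    forall n, 0 < u n < 1, forall n, u n = phi eps c (s n) (u n.+1) &
    forall n, 0 < lam (s n)].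
Proof.
move=> c_gt0 [_ _ K01 KE] [Kt tT0] cod.
have phi_inj i : injective (phi eps c i).
  move=> x y xy; apply/eqP; rewrite -subr_eq0 -normr_eq0.
  have := phi_dist eps c_gt0 i x y; rewrite xy subrr normr0 => /esym/eqP.
  by rewrite mulf_eq0 gt_eqF.
have word_inj w : injective (phi_word eps c w).
  by elim: w => [|i w IH] x y //= /phi_inj/IH.
have ex_u n : exists x, 0 <= x <= 1 /\ phi_word eps c (mkseq s n) x = t.
  have : (\bigcap_n (phi_word eps c (mkseq s n) @` `[0, 1])) t by rewrite cod.
  by move=> /(_ n I)[x /=]; rewrite in_itv/= => x01 xt; exists x.
have [u uP] := choice ex_u.
have uS n : u n = phi eps c (s n) (u n.+1).
  by apply: (word_inj (mkseq s n)); rewrite -phi_word_mkseqS !(uP _).2.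
have u01 n : 0 < u n < 1.
  have [/andP[u0 u1] ut] := uP n.
  rewrite !lt_neqAle u0 u1 !andbT eq_sym; apply/andP; split; apply/eqP => ue;
    apply: tT0; exists (mkseq s n); rewrite -ut ue; [by left|by right].
have u0t : u 0%N = t by have [_] := uP 0%N.
have step n : K (u n) -> 0 < lam (s n) /\ K (u n.+1).
  rewrite {1}KE => -[i /= li [v Kv vu]].
  have v01 : 0 <= v <= 1 by have := K01 _ Kv; rewrite /= in_itv.
  have si : s n = i.
    by apply: (phi_int_inj (eps := eps) c_gt0 (u01 n.+1) v01); rewrite -uS.
  split; first by rewrite si.
  suff -> : u n.+1 = v by [].
  by apply: (phi_inj i); rewrite vu -si -uS.
have Ku n : K (u n) by elim: n => [|n /step[]//]; rewrite u0t.
by exists u; split=> // n; have [] := step n (Ku n).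
Qed.

(** * Zooming along the orbit: from decay of weights to Hoelder bounds and back *)

Section Orbit.
Variables (R : realType) (q p : nat) (eps : 'I_p.+2 -> bool).
Variables (S : 'I_p.+2 -> 'rV[R]_q.+1 -> 'rV[R]_q.+1) (lam c : 'I_p.+2 -> R).
Variable f : R -> 'rV[R]_q.+1.
Hypothesis Hsys : self_affine_system eps S lam c.
Hypothesis Hf : self_affine_function eps S c f.
Variables (s : nat -> 'I_p.+2) (u : nat -> R).
Hypothesis u01 : forall n, 0 < u n < 1.
Hypothesis uS : forall n, u n = phi eps c (s n) (u n.+1).
Hypothesis lam_s : forall n, 0 < lam (s n).
Implicit Types (i : 'I_p.+2) (x y : R) (e : bool).

Let c_gt0 := sas_c Hsys.
Let c_sum := sas_sum Hsys.
Let lw := digit_prod s lam.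
Let cw := digit_prod s c.
Let lw_gt0 n : 0 < lw n. Proof. exact: digit_prod_gt0. Qed.
Let cw_gt0 n : 0 < cw n. Proof. exact: digit_prod_gt0. Qed.
Let u01w n : 0 <= u n <= 1. Proof. by have := u01 n; lra. Qed.

Lemma orbit_end_neq n e : u n != e%:R.
Proof. by have := u01 n; case: e => /=; lra. Qed.

(** The version of [end_ind] along the orbit: since u (n+1) is interior, u n can lie in the end
    interval at e only if s n is the end digit. *)
Lemma orbit_end_ind m (P : bool -> nat -> Prop) : 0 < m -> (forall i, m <= c i) ->
  (forall e n, m <= `|u n - e%:R| -> P e n) ->
  (forall e n, s n = end_digit p e -> P (end_shift eps e) n.+1 -> P e n) ->
  forall e n, P e n.
Proof.
move=> m0 cm Pfar Pstep e n.
have := end_ind (P := fun e x => forall n, u n = x -> P e n) Hsys m0 cm.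
apply => //; [|move=> {}e x x01 IH {}n unx|exact: orbit_end_neq].
  by move=> {}e x x01 mx {}n unx; apply: Pfar; rewrite unx.
have sn : s n = end_digit p e.
  by apply: (phi_int_inj (eps := eps) c_gt0 (u01 n.+1) x01); rewrite -uS.
apply: Pstep => //; apply: IH; apply/eqP; rewrite -subr_eq0 -normr_eq0.
have := phi_dist eps c_gt0 (end_digit p e) (u n.+1) x.
rewrite -unx -{1}sn -uS subrr normr0 => /esym/eqP.
by rewrite mulf_eq0 gt_eqF.
Qed.

Section Weights.
Variables (beta h : bool -> R).
Hypothesis Hbh : end_exponents eps lam c beta h.

(** While the orbit follows the coding of e, both [cw n * |u n - e|] and h e times the left side
    stay constant under (n, e) -> (n+1, shift of e). Once u n is at distance at least m from the
    endpoint, the decay of [lw] gives the bound. *)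
Lemma orbit_end_bound al C : 0 <= al -> (forall n, lw n <= C * cw n `^ al) ->
  exists2 C', 0 < C' & forall e n,
    lw n * `|u n - e%:R| `^ beta e <= C' * (cw n * `|u n - e%:R|) `^ al.
Proof.
move=> al0 HC; have [m m0 cm] := cmin_exists Hsys.
have h0 := end_h_gt0 Hbh.
have [k k0 kh] := fin_lower_bound true h0.
have hs0 : 0 < h true + h false by rewrite addr_gt0.
have C0 : 0 < C.
  by have := HC 0%N; rewrite /lw /cw !digit_prod0 powR1 mulr1; lra.
have ma0 : 0 < m `^ al by rewrite powR_gt0.
pose C1 := C * (h true + h false) / m `^ al.
have C10 : 0 < C1 by rewrite divr_gt0 ?mulr_gt0.
exists (C1 / k); first by rewrite divr_gt0.
move=> e n; rewrite mulrAC ler_pdivlMr// mulrC.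
apply: (@le_trans _ _ (h e * (lw n * `|u n - e%:R| `^ beta e))).
  by rewrite ler_wpM2r// mulr_ge0 ?powR_ge0// ltW.
move: e n; apply: (orbit_end_ind m0 cm) => [e n mu|e n sn IH].
  have d1 : `|u n - e%:R| <= 1.
    by have := u01 n; case: (e) => /= u01n; rewrite ler_norml; lra.
  have -> : C1 * (cw n * `|u n - e%:R|) `^ al = (h true + h false) *
      (C * cw n `^ al * ((m `^ al)^-1 * `|u n - e%:R| `^ al)).
    by rewrite powRM ?(ltW (cw_gt0 n))// /C1; ring.
  apply: ler_pM; rewrite ?(ltW (h0 _))//.
  + by rewrite mulr_ge0 ?powR_ge0// ltW.
  + by have := h0 (~~ e); case: (e) => /=; lra.
  apply: (@le_trans _ _ (lw n * 1)).
    rewrite ler_wpM2l ?(ltW (lw_gt0 n))// powR_le1 ?normr_ge0//.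
    exact: ltW (end_beta_gt0 Hbh e).
  rewrite mulr1; apply: le_trans (HC n) _.
  rewrite ler_peMr ?mulr_ge0 ?powR_ge0 ?(ltW C0)//.
  by rewrite mulrC ler_pdivlMr// mul1r le_powR// ltW.
rewrite [u n]uS -[in leRHS](phi_end eps c_sum e) -[in leLHS](phi_end eps c_sum e).
rewrite sn phi_dist//.
(* Equality holds because this end digit occurs in s and so has positive ratio. *)
have Heq : lam (end_digit p e) * h (end_shift eps e) =
    h e * c (end_digit p e) `^ beta e.
  by apply/le_anti; rewrite (end_lam_le Hbh) (end_lam_ge Hbh)// -sn.
move: IH; rewrite /lw /cw !digit_prodS sn (end_beta_shift Hbh).
rewrite [(c _ * _) `^ _]powRM ?(ltW (c_gt0 _))// !mulrA; apply: le_trans.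
rewrite le_eqVlt; apply/orP; left; apply/eqP.
transitivity (h e * c (end_digit p e) `^ beta e *
  (lw n * `|u n.+1 - (end_shift eps e)%:R| `^ beta e)); first by rewrite /lw; ring.
by rewrite -Heq /lw; ring.
Qed.

End Weights.

(* [n] is the last level at which [y] and [u 0] share an interval. *)
Lemma orbit_divergence y : 0 <= y <= 1 -> y != u 0 ->
  exists n i x, [/\ s n <> i, 0 <= x <= 1,
    `|y - u 0| = cw n * `|phi eps c i x - u n| &
    enorm (f y - f (u 0)) = lw n * enorm (f (phi eps c i x) - f (u n))].
Proof.
move=> y01 yt; have [m m0 cm] := cmin_exists Hsys.
have m1 : m < 1 by have := c_le1B c_gt0 c_sum ord0 cm; have := c_gt0 ord0; lra.
have d0 : 0 < `|y - u 0| by rewrite normr_gt0 subr_eq0.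
(* Each zoom divides the distance by at most 1 - m. After N common digits it would be at least 1,
   which is impossible because u k is interior; hence N counts the zooms left. *)
suff H N k v : 0 <= v <= 1 -> (1 - m) ^+ N <= `|v - u k| ->
  exists n i x, [/\ s n <> i, 0 <= x <= 1,
    cw k * `|v - u k| = cw n * `|phi eps c i x - u n| &
    lw k * enorm (f v - f (u k)) = lw n * enorm (f (phi eps c i x) - f (u n))].
  have [N HN] := @exprn_le_small _ (1 - m) _ ltac:(lra) d0.
  have [n [i [x []]]] := H N 0%N y y01 HN.
  by rewrite /cw /lw !digit_prod0 !mul1r => *; exists n, i, x.
elim: N k v => [|N IH] k v v01.
  rewrite expr0 => d1; have := u01 k.
  by move: d1; rewrite ler_normr; lra.
have [i [x [x01 ->]]] := phi_onto eps c_gt0 c_sum v01.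
have [<-|ski _] := eqVneq (s k) i; last by exists k, i, x; split=> //; exact/eqP.
rewrite {1}uS phi_dist// exprS => dN.
have [|n [j [z [nj z01 dE fE]]]] := IH k.+1 x x01.
  have := c_le1B c_gt0 c_sum (s k) cm.
  by have := exprn_ge0 N (ltac:(lra) : 0 <= 1 - m); have := c_gt0 (s k); nra.
exists n, j, z; split=> //.
- by rewrite -dE [u k]uS phi_dist// /cw digit_prodS mulrA.
- by rewrite -fE [u k]uS (f_phi_dist Hsys Hf)// /lw digit_prodS mulrA.
Qed.

(* The last hypothesis concerns points that approach [u n.+1] across the common
   endpoint, where [f] has the exponent [beta e'] of the neighbouring side. *)
Lemma hoelder_of_decay beta h al C D : end_exponents eps lam c beta h ->
  0 < al -> (forall n, lw n <= C * cw n `^ al) ->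
  (forall n j e e', s n <> j -> 0 < lam j ->
    phi eps c (s n) e%:R = phi eps c j e'%:R ->
    (e -> j = arrow eps (s n)) -> (e == e') = (eps (s n) != eps j) ->
    lw n.+1 * `|u n.+1 - e%:R| `^ beta e' <=
      D * (cw n.+1 * `|u n.+1 - e%:R|) `^ al) ->
  in_nd_hoelder f al (u 0).
Proof.
move=> Hbh al0 HC HD; have [m m0 cm] := cmin_exists Hsys.
have [M M0 HM] := f_osc Hf.
have [Ce Ce0 HCe] := end_hoelder Hsys Hf Hbh.
have [C' C'0 HC'] := orbit_end_bound Hbh (ltW al0) HC.
have C0 : 0 < C.
  by have := HC 0%N; rewrite /lw /cw !digit_prod0 powR1 mulr1; lra.
have [l l0 Hl] : exists2 l, 0 < l & forall i, l <= if 0 < lam i then lam i else 1.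
  by apply: (fin_lower_bound ord0) => i; case: ifP.
pose mb := m^-1 `^ beta true + m^-1 `^ beta false.
have mb_ge e : m^-1 `^ beta e <= mb.
  by rewrite /mb; case: e; rewrite ?lerDl ?lerDr powR_ge0.
pose Cf := C * M / m `^ al.
pose D' := Num.max C (D / l).
have D'0 : 0 < D' by rewrite lt_max C0.
have mb0 : 0 < mb by rewrite addr_gt0// powR_gt0// invr_gt0.
have Cf0 : 0 < Cf by rewrite divr_gt0 ?mulr_gt0 ?powR_gt0.
pose Cn := 2 * (Ce * C' + Ce * mb * D').
have Cn0 : 0 < Cn.
  have A0 : 0 < Ce * C' by rewrite mulr_gt0.
  have B0 : 0 < Ce * mb * D' by rewrite !mulr_gt0.
  by rewrite /Cn; lra.
exists (Cf + Cn) => y y01.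
have [->|yt] := eqVneq y (u 0).
  by rewrite enorm_subrr mulr_ge0 ?powR_ge0// ltW// addr_gt0.
have y01w : 0 <= y <= 1 by lra.
have [n [j [x [sj x01 -> ->]]]] := orbit_divergence y01w yt.
set r := `|_ - u n|.
have r_ge0 : 0 <= r by exact: normr_ge0.
have wr_ge0 : 0 <= (cw n * r) `^ al by exact: powR_ge0.
(* For separated intervals the oscillation of f suffices. Otherwise the increment of f is split at
   the common endpoint, into [first_term] on the side of u n and [second_term] on the neighbouring
   side. *)
have := phi_separation eps c_gt0 cm sj (u01w n.+1) x01.
rewrite -uS distrC -/r => -[mr|].
  apply: (@le_trans _ _ (Cf * (cw n * r) `^ al)); last first.
    by rewrite ler_wpM2r// lerDl ltW.
  rewrite powRM ?(ltW (cw_gt0 n))// /Cf.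
  have := HC n; have := HM _ _ (phi01 eps c_gt0 c_sum j x01) (u01w n) => fM lC.
  apply: (@le_trans _ _ (C * cw n `^ al * M)).
    by apply: ler_pM; rewrite ?enorm_ge0// ltW.
  rewrite (_ : C * M / m `^ al * _ =
      C * cw n `^ al * (M * ((m `^ al)^-1 * r `^ al))); last by ring.
  rewrite ler_wpM2l ?mulr_ge0 ?powR_ge0 ?(ltW C0)//.
  rewrite ler_peMr ?(ltW M0)// mulrC ler_pdivlMr ?powR_gt0//.
  by rewrite mul1r le_powR// ltW.
move=> [e [e' [pe rE He Hee]]].
apply: (@le_trans _ _ (Cn * (cw n * r) `^ al)); last first.
  by rewrite ler_wpM2r// lerDr ltW.
set z := `|u n.+1 - e%:R| in rE.
have z0 : 0 < z by rewrite normr_gt0 subr_eq0 orbit_end_neq.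
have y'0 : 0 <= `|x - e'%:R| by exact: normr_ge0.
have czr : c (s n) * z <= r by rewrite rE lerDl mulr_ge0// ltW.
have cz0 : 0 < c (s n) * z by rewrite mulr_gt0.
have r1 : r <= 1.
  have := phi01 eps c_gt0 c_sum j x01; have := u01w n.
  by rewrite /r ler_norml; lra.
have xr : `|x - e'%:R| <= m^-1 * r.
  rewrite mulrC ler_pdivlMr// rE mulrC; have := cm j; nra.
have first_term : lw n * enorm (f (u n) - f (phi eps c (s n) e%:R)) <=
    Ce * C' * (cw n * r) `^ al.
  rewrite [in leLHS]uS (f_phi_dist Hsys Hf) ?bool01// mulrA -/lw.
  have -> : lw n * lam (s n) = lw n.+1 by rewrite /lw digit_prodS.
  apply: (@le_trans _ _ (lw n.+1 * (Ce * z `^ beta e))).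
    by rewrite ler_wpM2l ?HCe// ltW.
  rewrite mulrCA -mulrA ler_pM2l//; apply: le_trans (HC' _ _) _.
  rewrite ler_pM2l// le_powR ?(ltW al0)//; first by rewrite mulr_ge0// ltW.
  by rewrite /cw digit_prodS -mulrA ler_pM2l.
have second_term : lw n * enorm (f (phi eps c j x) - f (phi eps c j e'%:R)) <=
    Ce * mb * D' * (cw n * r) `^ al.
  rewrite (f_phi_dist Hsys Hf) ?bool01//.
  have : 0 <= lam j by exact: lam_ge0 Hsys j.
  rewrite le_eqVlt => /orP[/eqP <-|lj].
    by rewrite mul0r mulr0 mulr_ge0// !mulr_ge0// ltW.
  (* At r = 1 this is the decay of [lw], at the smallest possible r = c (s n) z it is the crossing
     hypothesis, and [powR_ends_bound] fills in between. *)
  have lr : lw n * r `^ beta e' <= D' * (cw n * r) `^ al.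
    apply: (powR_ends_bound (z := c (s n) * z)); rewrite ?(ltW (lw_gt0 n)) ?czr//.
      apply: le_trans (HC n) _; rewrite ler_wpM2r ?powR_ge0// le_max lexx//.
    have := HD n j e e' sj lj pe He Hee.
    rewrite -/z /lw /cw !digit_prodS -/lw -/cw -[cw n * _ * z]mulrA => HDn.
    apply: (@le_trans _ _ (D / l * (cw n * (c (s n) * z)) `^ al)); last first.
      by rewrite ler_wpM2r ?powR_ge0// le_max lexx orbT.
    rewrite mulrAC ler_pdivlMr//; apply: le_trans HDn.
    rewrite mulrAC ler_pM ?mulr_ge0 ?powR_ge0// ?(ltW (lw_gt0 n)) ?(ltW l0)//.
      rewrite ler_wpM2l ?(ltW (lw_gt0 n))//.
      by have := Hl (s n); rewrite lam_s.
    apply: le_powR; rewrite ?(ltW (end_beta_gt0 Hbh _)) ?(ltW cz0)//.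
    have := c_le1B c_gt0 c_sum (s n) cm; nra.
  apply: (@le_trans _ _ (lw n * (Ce * (mb * r `^ beta e')))).
    rewrite ler_wpM2l ?(ltW (lw_gt0 n))//.
    apply: (@le_trans _ _ (enorm (f x - f e'%:R))).
      by rewrite ler_piMl ?enorm_ge0// ltW// (lam_lt1 Hsys).
    apply: le_trans (HCe _ _ x01) _; rewrite ler_pM2l//.
    have b0 := ltW (end_beta_gt0 Hbh e').
    apply: le_trans (le_powR b0 y'0 xr) _.
    by rewrite powRM ?invr_ge0 ?(ltW m0)// ler_wpM2r ?powR_ge0.
  rewrite (_ : lw n * _ = Ce * mb * (lw n * r `^ beta e')); last by ring.
  by rewrite -[leRHS]mulrA ler_pM2l// mulr_gt0.
have := enorm_triangle2 (f (phi eps c j x)) (f (phi eps c j e'%:R)) (f (u n)).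
rewrite (enormB (f (phi eps c j e'%:R))) -{2}pe => tri.
apply: le_trans (ler_wpM2l (ltW (lw_gt0 n)) tri) _.
by rewrite /Cn; lra.
Qed.

Lemma orbit_zoom n x : 0 <= x <= 1 -> exists x', [/\ 0 <= x' <= 1,
  `|x' - u 0| = cw n * `|x - u n| &
  enorm (f x' - f (u 0)) = lw n * enorm (f x - f (u n))].
Proof.
elim: n x => [|n IH] x x01.
  by exists x; rewrite /cw /lw !digit_prod0 !mul1r.
have [x' [x'01 dx fx]] := IH _ (phi01 eps c_gt0 c_sum (s n) x01).
exists x'; split=> //.
  by rewrite dx [u n]uS phi_dist// /cw digit_prodS mulrA.
by rewrite fx [u n]uS (f_phi_dist Hsys Hf)// /lw digit_prodS mulrA.
Qed.

(** Points near u n are carried to level 0 by [orbit_zoom], where the Hoelder condition compares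
    each of them with u 0. *)
Lemma decay_of_hoelder (al : R) : 0 < al -> in_nd_hoelder f al (u 0) ->
  exists2 C, 0 < C & forall n (r : R) x y, 0 <= x <= 1 -> 0 <= y <= 1 ->
    `|x - u n| <= r -> `|y - u n| <= r ->
    lw n * enorm (f x - f y) <= C * (cw n * r) `^ al.
Proof.
move=> al0 [C HC]; have [M M0 HM] := f_osc Hf.
(* The Hoelder condition covers only points of (0,1). The endpoints 0 and 1 are at distance at least
   d from u 0, so the oscillation [M] handles them. *)
pose d := Num.min (u 0) (1 - u 0).
have d0 : 0 < d by rewrite lt_min; have := u01 0; lra.
have da0 : 0 < d `^ al by rewrite powR_gt0.
pose D := `|C| + M / d `^ al.
have D0 : 0 < D by rewrite ltr_wpDl// divr_gt0.
have HD x : 0 <= x <= 1 -> enorm (f x - f (u 0)) <= D * `|x - u 0| `^ al.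
  move=> x01; have [xi|xe] := boolP (0 < x < 1).
    apply: le_trans (HC _ xi) _; rewrite ler_wpM2r ?powR_ge0//.
    by rewrite (le_trans (ler_norm C))// lerDl divr_ge0// ltW.
  have dx : d <= `|x - u 0|.
    rewrite ge_min !ler_normr; have [->|x0] := eqVneq x 0; first by lra.
    have [->|x1] := eqVneq x 1; first by lra.
    by move: xe; rewrite !lt_neqAle eq_sym x0 x1/=; lra.
  apply: (@le_trans _ _ (M / d `^ al * d `^ al)).
    by rewrite divfK ?gt_eqF//; exact: HM.
  apply: ler_pM; rewrite ?powR_ge0//; first by rewrite divr_ge0// ltW.
    by rewrite lerDr.
  by rewrite le_powR// ltW.
exists (4 * D); first by rewrite mulr_gt0.
move=> n r x y x01 y01 xr yr.
have zoom z : 0 <= z <= 1 -> `|z - u n| <= r ->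
    lw n * enorm (f z - f (u n)) <= D * (cw n * r) `^ al.
  move=> z01 zr; have [z' [z'01 dz <-]] := orbit_zoom n z01.
  apply: le_trans (HD _ z'01) _; rewrite ler_pM2l// dz.
  by apply: le_powR; rewrite ?(ltW al0) ?mulr_ge0 ?ler_wpM2l// ltW.
have := zoom _ x01 xr; have := zoom _ y01 yr; rewrite (enormB (f y)).
have := ler_wpM2l (ltW (lw_gt0 n)) (enorm_triangle2 (f x) (f (u n)) (f y)).
by lra.
Qed.

Lemma weight_decay_of_hoelder (al : R) : 0 < al -> in_nd_hoelder f al (u 0) ->
  exists C, forall n, lw n <= C * cw n `^ al.
Proof.
move=> al0 /(decay_of_hoelder al0)[C C0 HC]; exists C => n.
have := HC n 1 0 1; rewrite !mulr1 (f_ends_dist Hsys Hf) mulr1.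
apply; rewrite ?lexx ?ler01//.
all: by have := u01 n; rewrite ler_norml; lra.
Qed.

Let C_gt0 C al n : lw n <= C * cw n `^ al -> 0 < C.
Proof.
move=> H; have := lt_le_trans (lw_gt0 n) H.
by rewrite pmulr_lgt0// powR_gt0.
Qed.

Lemma hoelder_same_ends al C : eps ord0 || eps ord_max -> 0 < al ->
  (forall n, ln (lw n) + al * - ln (cw n) <= C) -> in_nd_hoelder f al (u 0).
Proof.
move=> e1 al0 HC; have {}HC n : lw n <= expR C * cw n `^ al by rewrite -decay_lnE.
have [beta [h [Hbh bb]]] := end_exponents_same Hsys e1.
have [D D0 HD] := orbit_end_bound Hbh (ltW al0) HC.
apply: (hoelder_of_decay Hbh al0 HC (D := D)) => n j e e' _ _ _ _ _.
rewrite (_ : beta e' = beta e); first exact: HD.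
by case: e; case: e'.
Qed.

Lemma decay_same_ends al : 0 < al -> in_nd_hoelder f al (u 0) ->
  exists C, forall n, ln (lw n) + al * - ln (cw n) <= C.
Proof.
move=> al0 /(weight_decay_of_hoelder al0)[C HC].
exists (ln C) => n; rewrite decay_lnE// lnK// posrE.
exact: C_gt0 (HC 0%N).
Qed.

(** * The case eps_1 = eps_m = 0: runs of the digit m and the correction term *)

Section FixedEnds.
Hypothesis eps0 : eps ord0 = false.
Hypothesis epsm : eps ord_max = false.

Let phi_ord0 x : phi eps c ord0 x = c ord0 * x.
Proof. by rewrite phiE eps0 start_ord0 add0r. Qed.

Let phi_ord_max1 : phi eps c ord_max 1 = 1.
Proof. by have := phi_end eps c_sum true; rewrite /end_shift epsm. Qed.

Lemma run_near1 n k : (forall j, (j < k)%N -> s (n + j) = ord_max) ->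
  `|1 - u n| <= c ord_max ^+ k.
Proof.
elim: k n => [|k IH] n run; first by have := u01 n; rewrite expr0 ler_norml; lra.
have sn : s n = ord_max by have := run 0%N (ltn0Sn k); rewrite addn0.
have : `|1 - u n| = c ord_max * `|1 - u n.+1|.
  by rewrite -{1}phi_ord_max1 uS sn phi_dist.
move=> ->; rewrite exprS ler_pM2l//; apply: IH => j jk.
by rewrite addSnnS run.
Qed.

(* The points c_1^l are the images of 1 under the iterates of phi_1. *)
Lemma f_osc_near0 b d : 0 < b -> lam ord0 = c ord0 `^ b -> 0 < d <= 1 ->
  exists y, [/\ 0 <= y <= 1, y <= d & (c ord0 * d) `^ b <= enorm (f 0 - f y)].
Proof.
move=> b0 lamE /andP[d0 d1]; have c0 := c_gt0 ord0.
have c1 : c ord0 < 1.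
  have [m m0 cm] := cmin_exists Hsys.
  by have := c_le1B c_gt0 c_sum ord0 cm; lra.
have cl l : 0 <= c ord0 ^+ l <= 1 by rewrite exprn_ge0 ?exprn_ile1 ?ltW.
have fl l : enorm (f 0 - f (c ord0 ^+ l)) = (c ord0 ^+ l) `^ b.
  elim: l => [|l IH]; first by rewrite expr0 (f_ends_dist Hsys Hf) powR1.
  rewrite exprS -phi_ord0 -[in f 0](mulr0 (c ord0)) -phi_ord0.
  rewrite (f_phi_dist Hsys Hf) ?lexx ?ler01// IH phi_ord0 lamE powRM ?(ltW c0)//.
  by case/andP: (cl l).
have ex_l : exists l, c ord0 ^+ l <= d.
  by apply: exprn_le_small => //; rewrite ltW.
have [l cld min_l] := ex_minnP ex_l.
exists (c ord0 ^+ l); split=> //; rewrite fl; apply: le_powR.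
- exact: ltW.
- by rewrite mulr_ge0// ltW.
case: l cld min_l => [|l] _ min_l.
  by rewrite expr0 mulr_ile1// ltW.
rewrite exprS ler_pM2l// leNgt; apply/negP => /ltW/min_l.
by rewrite ltnn.
Qed.

(** After k digits m, u n is within c_m^k of the point phi_(s n)(1), which is also phi_j(0) for j =
    [arrow eps (s n)]. On the side of j, f oscillates by a multiple of c_m^(k b) at this scale, and
    c_m^(k b) = lam_m^k e^(k K). *)
Lemma run_decay_of_hoelder (al b K : R) : 0 < al -> 0 < b ->
  lam ord0 = c ord0 `^ b -> lam ord_max * expR K = c ord_max `^ b ->
  in_nd_hoelder f al (u 0) ->
  exists C, forall n k, s n <> ord_max ->
    (forall j, (j < k)%N -> s (n.+1 + j) = ord_max) ->
    eps (s n) = eps (arrow eps (s n)) -> 0 < lam (arrow eps (s n)) ->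
    lw (n.+1 + k) * expR (K * k%:R) <= C * cw (n.+1 + k) `^ al.
Proof.
move=> al0 b0 lam0E lammE Hal; have [C C0 HC] := decay_of_hoelder al0 Hal.
have [m m0 cm] := cmin_exists Hsys.
have [l l0 Hl] : exists2 l, 0 < l & forall i, l <= if 0 < lam i then lam i else 1.
  by apply: (fin_lower_bound ord0) => i; case: ifP.
have ca0 : 0 < c ord0 `^ b by rewrite powR_gt0.
(* The 2 comes from the radius 2 d, m from c (s n), [l] from lam j, and c_1^b from the choice of y
   in [f_osc_near0]. *)
exists (C * (2 / m) `^ al / (l * c ord0 `^ b)) => n k snm run ee lj.
have [sj pj] := phi_arrow c eps0 snm ee.
have cm1 : c ord_max <= 1.
  by have := c_le1B c_gt0 c_sum ord_max cm; lra.
pose d := c ord_max ^+ k.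
have d01 : 0 < d <= 1.
  by rewrite exprn_gt0// exprn_ile1// ltW.
have [y [y01 yd fy]] := f_osc_near0 b0 lam0E d01.
set j := arrow eps (s n) in sj pj lj.
have c1 i : c i <= 1 by have := c_le1B c_gt0 c_sum i cm; lra.
have near1 : `|phi eps c j 0 - u n| <= d.
  rewrite -pj uS phi_dist//; apply: le_trans (run_near1 run).
  by rewrite ler_piMl.
have y0 : 0 <= y by case/andP: y01.
have nearY : `|phi eps c j y - u n| <= 2 * d.
  apply: le_trans (ler_distD (phi eps c j 0) _ _) _.
  rewrite phi_dist// subr0 ger0_norm//.
  by have := c1 j; have := c_gt0 j; have := c1 j; nra.
have near1' : `|phi eps c j 0 - u n| <= 2 * d by lra.
have z01 : 0 <= (0 : R) <= 1 by rewrite lexx ler01.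
have phi01j := phi01 eps c_gt0 c_sum j.
have := HC n (2 * d) _ _ (phi01j _ z01) (phi01j _ y01) near1' nearY.
rewrite (f_phi_dist Hsys Hf)// => H.
have lamj : l <= lam j by have := Hl j; rewrite lj.
have powE : lw (n.+1 + k) * expR (K * k%:R) = lw n.+1 * d `^ b.
  rewrite /lw (digit_prod_run _ run) -mulrA; congr (_ * _).
  rewrite expRM_natr -exprMn lammE -(powR_mulrn k (powR_ge0 _ _)) -powRrM mulrC.
  by rewrite powRrM powR_mulrn// ltW.
have cwE : cw (n.+1 + k) = cw n * c (s n) * d.
  by rewrite /cw (digit_prod_run _ run) digit_prodS.
rewrite powE mulrAC ler_pdivlMr ?mulr_gt0//.
apply: (@le_trans _ _ (lw n * (lam j * enorm (f 0 - f y)))).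
  rewrite /lw digit_prodS -/lw -!mulrA ler_pM2l//.
  apply: (@le_trans _ _ (l * (c ord0 * d) `^ b)).
    rewrite powRM ?(ltW (c_gt0 _)) ?(ltW (andP d01).1)//.
    rewrite [leLHS](_ : _ = lam (s n) * (l * (c ord0 `^ b * d `^ b))); last by ring.
    by rewrite ler_piMl ?(ltW (lam_lt1 Hsys _))// !mulr_ge0 ?powR_ge0// ltW.
  by apply: ler_pM => //; rewrite ?powR_ge0// ltW.
apply: le_trans H _; rewrite -mulrA ler_pM2l//.
rewrite -powRM ?mulr_ge0 ?invr_ge0 ?(ltW m0) ?(ltW (cw_gt0 _))//.
case/andP: d01 => d0 d1.
apply: le_powR; first exact: ltW.
  by rewrite !mulr_ge0// ltW.
rewrite cwE (_ : 2 / m * _ = (c (s n) / m) * (cw n * (2 * d))); last by ring.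
rewrite ler_peMl ?mulr_ge0 ?(ltW d0) ?(ltW (cw_gt0 n))//.
by rewrite ler_pdivlMr// mul1r.
Qed.

(** The argument of [orbit_end_bound] at the endpoint 1, with an exponent b that need not be the one
    of f at 1: a factor e^K per digit m restores the invariance, since lam_m e^K = c_m^b. *)
Lemma orbit_run_bound (al b K C m : R) n : 0 <= al -> 0 < b -> 0 < C ->
  0 < m -> (forall i, m <= c i) ->
  (0 < lam ord_max -> lam ord_max * expR K = c ord_max `^ b) ->
  (forall k, (forall j, (j < k)%N -> s (n + j) = ord_max) ->
    lw (n + k) * expR (K * k%:R) <= C * cw (n + k) `^ al) ->
  lw n * `|u n - 1| `^ b <= C / m `^ al * (cw n * `|u n - 1|) `^ al.
Proof.
move=> al0 b0 C0 m0 cm lammE Hrun.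
have ma0 : 0 < m `^ al by rewrite powR_gt0.
(* The induction ranges over both endpoints, so e = 1 becomes a premise; k counts the digits m read
   since level n. *)
suff H e n' : e -> forall k, n' = (n + k)%N ->
    (forall j, (j < k)%N -> s (n + j) = ord_max) ->
    lw n' * expR (K * k%:R) * `|u n' - 1| `^ b <=
      C / m `^ al * (cw n' * `|u n' - 1|) `^ al.
  have := H true n erefl 0%N; rewrite addn0 mulr0 expR0 mulr1.
  by apply => // j; rewrite ltn0.
move: e n'; apply: (orbit_end_ind m0 cm) =>
  [[]//= n' mu _ k n'E run|[]//= n' sn' IH _ k n'E run].
  apply: (@le_trans _ _ (lw n' * expR (K * k%:R))).
    rewrite ler_piMr ?mulr_ge0 ?expR_ge0 ?(ltW (lw_gt0 _))//.
    by apply: powR_le1; [exact: ltW|have := u01 n'; rewrite normr_ge0 ler_norml; lra].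
  rewrite n'E; apply: le_trans (Hrun k run) _; rewrite -n'E.
  rewrite powRM ?(ltW (cw_gt0 _))//.
  rewrite (_ : C / _ * _ =
      C * cw n' `^ al * ((m `^ al)^-1 * `|u n' - 1| `^ al)); last by ring.
  rewrite ler_peMr ?mulr_ge0 ?powR_ge0 ?(ltW C0)//.
  by rewrite mulrC ler_pdivlMr// mul1r le_powR// ltW.
have dE : `|u n' - 1| = c ord_max * `|u n'.+1 - 1|.
  by rewrite -{1}phi_ord_max1 uS sn' phi_dist.
have := IH _ k.+1; rewrite n'E addnS => /(_ _ erefl); rewrite -n'E.
rewrite /end_shift epsm /= => /(_ erefl) H.
have run' j : (j < k.+1)%N -> s (n + j)%N = ord_max.
  by rewrite ltnS leq_eqVlt => /orP[/eqP ->|/run//]; rewrite -n'E.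
have {}H := H run'.
move: H; rewrite /lw /cw !digit_prodS sn' dE -!mulrA; apply: le_trans.
have lm0 : 0 < lam ord_max by rewrite -sn'.
rewrite -natr1 mulrDr mulr1 expRD powRM ?(ltW (c_gt0 _))// -lammE//.
by rewrite le_eqVlt; apply/orP; left; apply/eqP; ring.
Qed.

Hypothesis Hratio : (log_ratio lam c ord0 <= log_ratio lam c ord_max)%E.

Let K := Kcst lam c.

(** This is n times the correction term, to be added to ln lam^(n). *)
Definition run_boost n : R := K * (chi eps lam s n)%:R * (runlen s n)%:R.

Lemma run_boost_run n k : s n <> ord_max ->
  (forall j, (j < k)%N -> s (n.+1 + j) = ord_max) ->
  eps (s n) = eps (arrow eps (s n)) -> 0 < lam (arrow eps (s n)) ->
  run_boost (n.+1 + k) = K * k%:R.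
Proof.
move=> sn run ee la; rewrite /run_boost /chi runlen_run//.
by rewrite addnK /= ee eqxx la/= mulr1.
Qed.

Lemma run_boost_cases n : run_boost n = 0 \/ exists n' k,
  [/\ n = (n'.+1 + k)%N, s n' <> ord_max, 0 < lam ord_max,
    forall j, (j < k)%N -> s (n'.+1 + j) = ord_max &
    eps (s n') = eps (arrow eps (s n')) /\ 0 < lam (arrow eps (s n'))].
Proof.
have [run|[n' [k [-> sn' run]]]] := run_decomposition s n.
  by left; rewrite /run_boost /chi runlen_all// subnn mulr0 mul0r.
case: k run => [|k] run.
  by left; rewrite /run_boost runlen_run// mulr0.
have [/andP[/eqP ee la]|nchi] :=
    boolP ((eps (s n') == eps (arrow eps (s n'))) && (0 < lam (arrow eps (s n')))).
  right; exists n', k.+1; split=> //.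
  by have := lam_s (n'.+1 + 0); rewrite run.
by left; rewrite /run_boost /chi runlen_run// addnK /= (negbTE nchi) mulr0 mul0r.
Qed.

Lemma Kcst_ge0 : 0 <= K.
Proof. by have [beta [_ _ _ _]] := end_exponents_split Hsys eps0 epsm Hratio. Qed.

Lemma run_boost_ge0 n : 0 <= run_boost n.
Proof. by rewrite /run_boost !mulr_ge0 ?Kcst_ge0. Qed.

Lemma hoelder_fixed_ends al C : 0 < al ->
  (forall n, ln (lw n) + run_boost n + al * - ln (cw n) <= C) ->
  in_nd_hoelder f al (u 0).
Proof.
move=> al0 HC.
have HLam n : lw n * expR (run_boost n) <= expR C * cw n `^ al.
  rewrite -decay_lnE ?mulr_gt0 ?expR_gt0// lnM ?posrE ?expR_gt0//.
  by rewrite expRK.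
have Hlw n : lw n <= expR C * cw n `^ al.
  rewrite -decay_lnE//; apply: le_trans (HC n).
  by have := run_boost_ge0 n; lra.
have [beta [Hb b01 lam0E lammE K0]] := end_exponents_split Hsys eps0 epsm Hratio.
have [D D0 HD] := orbit_end_bound Hb (ltW al0) Hlw.
have [m m0 cm] := cmin_exists Hsys.
have E0 : 0 < expR C / m `^ al by rewrite divr_gt0 ?expR_gt0 ?powR_gt0.
apply: (hoelder_of_decay Hb al0 Hlw (D := D + expR C / m `^ al)).
move=> n j e e' sj lj pe He Hee.
set z := `|u n.+1 - e%:R|.
have z01 : 0 < z <= 1.
  rewrite normr_gt0 subr_eq0 orbit_end_neq//=.
  by have := u01 n.+1; rewrite /z; case: (e) => /= u01n; rewrite ler_norml; lra.
have w0 : 0 <= (cw n.+1 * z) `^ al by exact: powR_ge0.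
have [bee|] := leP (beta e) (beta e').
  apply: (@le_trans _ _ (lw n.+1 * z `^ beta e)).
    by rewrite ler_wpM2l ?(ltW (lw_gt0 _))// ger_powR.
  apply: le_trans (HD e n.+1) _.
  by rewrite ler_wpM2r// lerDl ltW.
(* Since beta_0 <= beta_1, only e = 1, e' = 0 remains. Then j is the arrow neighbour with the same
   orientation and positive ratio, so the chi factor is 1 and the boosted decay applies along the
   run. *)
case: e e' pe He Hee @z z01 w0 => -[] pe He Hee z z01 w0;
  rewrite ?ltxx ?ltNge ?b01// => _.
have jE : j = arrow eps (s n) by exact: He.
have ee : eps (s n) = eps j by move: Hee; case: (eps (s n)); case: (eps j).
have snm : s n <> ord_max.
  move=> snm; move: pe; rewrite !phiE -ee snm epsm !mulr0 mulr1 addr0 start_ord_max//.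
  by have := start_le1 c_gt0 c_sum j; have := c_gt0 j; lra.
apply: (@le_trans _ _ (expR C / m `^ al * (cw n.+1 * z) `^ al)); last first.
  by rewrite ler_wpM2r// lerDr ltW.
apply: (orbit_run_bound (ltW al0)) lammE _ => //.
- exact: end_beta_gt0 Hb _.
- exact: expR_gt0.
by move=> k run; rewrite -(run_boost_run snm run) -?jE.
Qed.

Lemma decay_fixed_ends al : 0 < al -> in_nd_hoelder f al (u 0) ->
  exists C, forall n, ln (lw n) + run_boost n + al * - ln (cw n) <= C.
Proof.
move=> al0 Hal; have [C1 HC1] := decay_same_ends al0 Hal.
have [beta [Hb b01 lam0E lammE K0]] := end_exponents_split Hsys eps0 epsm Hratio.
(* If lam_m = 0, the digit m never occurs and the boost vanishes. *)
have [lm|lm] := ltP 0 (lam ord_max); last first.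
  exists C1 => n; have [->|[n' [k [_ _]]]] := run_boost_cases n; first by rewrite addr0.
  by rewrite ltNge lm.
have l0 := lam_ord0_gt0 Hsys Hratio lm.
have [C2 HC2] := run_decay_of_hoelder al0 (end_beta_gt0 Hb false)
  (lam0E l0) (lammE lm) Hal.
exists (Num.max C1 (ln C2)) => n; rewrite le_max.
have [->|[n' [k [-> sn' _ run [ee la]]]]] := run_boost_cases n.
  by rewrite addr0 HC1.
rewrite run_boost_run//; apply/orP; right.
have H := HC2 n' k sn' run ee la.
have ek : 0 < expR (K * k%:R) by exact: expR_gt0.
have C20 : 0 < C2.
  have := lt_le_trans (mulr_gt0 (lw_gt0 _) ek) H.
  by rewrite pmulr_lgt0// powR_gt0.
rewrite -[in leLHS](expRK (K * k%:R)) -lnM ?posrE//.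
by rewrite decay_lnE ?mulr_gt0// lnK.
Qed.

(** A boosted run behaves like k digits of log ratio beta_0, which is the log ratio of the digit 1
    and so is at least [lo]. Hence the correction does not push the exponent below alpha_min. *)
Lemma run_boost_growth lo : 0 < lo ->
  (forall i, 0 < lam i -> ln (lam i) <= lo * ln (c i)) ->
  forall n, ln (lw n) + run_boost n <= lo * ln (cw n).
Proof.
move=> lo0 Hlo n.
have [beta [Hb b01 lam0E lammE K0]] := end_exponents_split Hsys eps0 epsm Hratio.
have Hlw k : ln (lw k) <= lo * ln (cw k).
  by apply: ln_digit_prod_le => // j; exact: Hlo.
have [->|[n' [k [-> sn' lm run [ee la]]]]] := run_boost_cases n; first by rewrite addr0.
have l0 := lam_ord0_gt0 Hsys Hratio lm.
rewrite run_boost_run// /lw /cw !(digit_prod_run _ run).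
rewrite !lnM ?posrE ?exprn_gt0// !lnXn// -/lw -/cw.
have lob : lo <= beta false.
  have := Hlo _ l0; rewrite {1}(lam0E l0) ln_powR.
  by rewrite ler_nM2r// (ln_c_lt0 Hsys).
have KE : ln (lam ord_max) + K = beta false * ln (c ord_max).
  by rewrite -ln_powR -(lammE lm) lnM ?posrE ?expR_gt0// expRK.
have : (ln (lam ord_max) + K) * k%:R <= lo * ln (c ord_max) * k%:R.
  by rewrite KE ler_wpM2r// ler_nM2r// (ln_c_lt0 Hsys).
rewrite -(mulr_natr (ln (lam _))) -(mulr_natr (ln (c _))).
move=> /(lerD (Hlw n'.+1)).
by rewrite mulrDl [lo * (_ + _)]mulrDr !mulrA addrA.
Qed.

End FixedEnds.

End Orbit.

(** * Uniqueness of the roots, and assembly of both cases *)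

Lemma unique_limsup_root (R : realType) (a b : nat -> R) (bl bu lo hi x : R)
    (F : R -> nat -> \bar R) :
  0 < bl -> (forall n, bl * n%:R <= b n <= bu * n%:R) ->
  growth_exponent a b x -> lo <= x <= hi ->
  (forall y n, F y n = ((a n + y * b n) / n%:R)%:E) ->
  unique (fun y => (lo%:E <= y%:E <= hi%:E)%E /\ limn_esup (F y) = 0%E) x.
Proof.
move=> bl0 bn ax xlohi FE.
have FE' y : F y = fun n => ((a n + y * b n) / n%:R)%:E by apply/funext => n.
split=> [|y [_]]; rewrite FE'.
  by split; [rewrite !lee_fin|apply/(growth_exponent_limn_esup _ bl0 bn ax)].
by move=> /(growth_exponent_limn_esup _ bl0 bn ax) ->.
Qed.

Unset Implicit Arguments.

Theorem theorem6p1 (R : realType) (q p : nat)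
  (eps : 'I_p.+2 -> bool)
  (S : 'I_p.+2 -> 'rV[R]_q.+1 -> 'rV[R]_q.+1)
  (lam c : 'I_p.+2 -> R)
  (f : R -> 'rV[R]_q.+1)
  (K : set R) (t : R) (s : nat -> 'I_p.+2)
  (Hsys : self_affine_system eps S lam c)
  (Hf : self_affine_function eps S c f)
  (Hratio : (log_ratio lam c ord0 <= log_ratio lam c ord_max)%E)
  (HK : is_K_phi eps lam c K)
  (HtK : (K `\` T0 eps c) t)
  (Hs : is_standard_coding eps c s t) :
  exists alpha0 : R,
    [/\ unique (is_alpha0 lam c s) alpha0,
        maxn (eps ord0) (eps ord_max) = 1%N ->
          nd_hoelder_exponent f t = alpha0%:E &
        eps ord0 = 0%N :> nat -> eps ord_max = 0%N :> nat ->
          exists alpha1 : R,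
            [/\ unique (is_alpha1 eps lam c s) alpha1,
                alpha1 <= alpha0 &
                nd_hoelder_exponent f t = alpha1%:E]].
Proof.
have c_gt0 := sas_c Hsys.
have [u [<- u01 uS lam_s]] := coding_orbit c_gt0 HK HtK Hs.1.
have [lo [lo0 loE Hlo]] := alpha_min_real Hsys (lam_s 0).
have [hi [hiE Hhi]] := alpha_max_real Hsys (lam_s 0).
have [bl [bu [bl0 bn]]] := ln_digit_prod_linear s c_gt0 (sas_sum Hsys).
have blb n : bl * n%:R <= - ln (digit_prod s c n) by case/andP: (bn n).
have lw_lo n : ln (digit_prod s lam n) + lo * - ln (digit_prod s c n) <= 0.
  rewrite mulrN subr_le0; apply: ln_digit_prod_le => // k; exact: Hlo.
have lw_hi n : 0 <= ln (digit_prod s lam n) + hi * - ln (digit_prod s c n).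
  rewrite mulrN subr_ge0; apply: ln_digit_prod_ge => // k; exact: Hhi.
have [x0 x0lohi gx0] := growth_exponent_exists bl0 blb lw_lo lw_hi.
have pos x : lo <= x <= hi -> 0 < x by move=> /andP[/(lt_le_trans lo0)].
exists x0; split.
- rewrite /is_alpha0 loE hiE; apply: (unique_limsup_root bl0 bn gx0 x0lohi) => y n.
  exact: weighted_sumE (lam_ge0 Hsys) _ lam_s.
- move=> e1; have {}e1 : eps ord0 || eps ord_max.
    by move: e1; case: (eps ord0); case: (eps ord_max).
  apply: (hoelder_exponent_of_growth (pos _ x0lohi) bl0 blb gx0).
    by move=> al C; exact: (hoelder_same_ends Hsys Hf u01 uS lam_s e1).
  by move=> al; exact: (decay_same_ends Hsys Hf u01 uS lam_s).
move=> e0 em.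
have {}e0 : eps ord0 = false by move: e0; case: (eps ord0).
have {}em : eps ord_max = false by move: em; case: (eps ord_max).
have boost0 := run_boost_ge0 Hsys s e0 em Hratio.
(* The exponent alpha_1 arises as alpha_0 does, from boosted weights. As the boost is nonnegative,
   the bound [hi] persists and alpha_1 <= alpha_0. *)
pose a n := ln (digit_prod s lam n) + run_boost eps lam c s n.
have [x1 x1lohi gx1] : exists2 x, lo <= x <= hi &
    growth_exponent a (fun n => - ln (digit_prod s c n)) x.
  apply: (growth_exponent_exists bl0 blb) => n; rewrite /a.
    by rewrite mulrN subr_le0; exact: (run_boost_growth Hsys lam_s e0 em Hratio).
  by have := lw_hi n; have := boost0 n; lra.
exists x1; split.
- rewrite /is_alpha1 loE hiE; apply: (unique_limsup_root bl0 bn gx1 x1lohi) => y n.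
  rewrite (weighted_sumE _ _ (lam_ge0 Hsys))// -EFinD /a /run_boost.
  by congr EFin; ring.
- by apply: growth_exponent_le gx0 gx1 => n; rewrite /a lerDl.
apply: (hoelder_exponent_of_growth (pos _ x1lohi) bl0 blb gx1).
  by move=> al C; exact: (hoelder_fixed_ends Hsys Hf u01 uS lam_s e0 em Hratio).
by move=> al; exact: (decay_fixed_ends Hsys Hf u01 uS lam_s e0 em Hratio).
Qed.
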